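(* Let $n\ge 3$, let $\mathcal{F}=\{\Omega_{i_1j_1},\dots,\Omega_{i_mj_m}\}\subseteq\mathcal{B}$ with $1\le i_k<j_k\le n$, and consider the control system on $\mathrm{SO}(n)$ $$\dot X(t)=\Big[\sum_{s=1}^m u_s(t)\,\Omega_{i_sj_s}\Big]X(t),\qquad X(0)=I.$$ Let $\sigma_1,\dots,\sigma_k\in S_n$ be disjoint cycles with respective nontrivial orbits $\mathcal{O}_1,\dots,\mathcal{O}_k$. Then the controllable submanifold of the system is the integral manifold (through $I$) of the involutive distribution $\Delta=\Delta_1\oplus\cdots\oplus\Delta_k$, where $\Delta_l=\mathrm{span}\{\Omega_{ij}X: i,j\in\mathcal{O}_l\}$ for $l=1,\dots,k$, if and only if $\tilde\iota(\mathcal{F})=[\sigma_1\cdot\sigma_2\cdots\sigma_k]$.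
   Context: $E_{ij}\in\mathbb{R}^{n\times n}$ is the matrix whose $(i,j)$ entry is $1$ and whose other entries are $0$; $\Omega_{ij}=E_{ij}-E_{ji}$; $\mathcal{B}=\{\Omega_{ij}:1\le i<j\le n\}$ is the standard basis of $\mathfrak{so}(n)$. The controls $u_s(t)\in\mathbb{R}$ are piecewise constant; the controllable submanifold is the set of states reachable from $X(0)=I$ in finite time. Integral manifolds are maximal integral manifolds. $S_n$ is the symmetric group on $\{1,\dots,n\}$ with operation ''$\cdot$''. The nontrivial orbit of a cycle is its unique orbit with more than one element. For $\sigma,\eta\in S_n$, $\sigma\sim\eta$ iff they have the same orbits on $\{1,\dots,n\}$; $[\sigma]$ is the class of $\sigma$. For transpositions, $\sigma*\eta=\sigma$ if $\sigma=\eta$ and $\sigma*\eta=\sigma\cdot\eta$ otherwise. More generally, for $\sigma\in S_n$ and a transposition $\tau=(i,j)$, $\sigma*\tau=\sigma$ if $i,j$ lie in the same orbit of $\sigma$, and $\sigma*\tau=\sigma\cdot\tau$ otherwise; a product $\sigma*\eta$ is obtained by writing $\eta$ as a product of a minimal number of transpositions and applying this rule successively. This induces a commutative, associative operation $[\sigma]*[\eta]=[\sigma*\eta]$ on $S_n/\!\sim$. The map $\tilde\iota:\mathcal{P}(\mathcal{B})\to S_n/\!\sim$ is given by $\{\Omega_{a_1b_1},\dots,\Omega_{a_lb_l}\}\mapsto[(a_1,b_1)*\cdots*(a_l,b_l)]$, where $(a,b)$ is the transposition exchanging $a$ and $b$, with $\tilde\iota(\varnothing)=[e]$, $e$ the identity.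 *)

(* Defs.v *)
From HB Require Import structures.
From mathcomp Require Import all_boot all_order all_algebra all_fingroup.
From mathcomp Require Import zify.
From mathcomp Require Import all_classical all_reals all_analysis.
Import Order.TTheory GRing.Theory Num.Theory.
Import numFieldNormedType.Exports.
Set Implicit Arguments.
Unset Strict Implicit.
Unset Printing Implicit Defensive.
Local Open Scope classical_set_scope.
Local Open Scope ring_scope.

Definition Omega (R : realType) (n : nat) (i j : 'I_n) : 'M[R]_n :=
  delta_mx i j - delta_mx j i.

Definition SO (R : realType) (n : nat) : set 'M[R]_n :=
  [set X | X^T *m X = 1%:M /\ \det X = 1].

Definition subdivision (R : realType) (T : R) (N : nat) (t : nat -> R) : Prop :=
  [/\ t 0%N = 0, t N = T & forall a, (a < N)%N -> t a < t a.+1].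

(* Controls are constant, and the differential equation holds, on the open
   pieces of a finite subdivision of [0, T]; at the break points the state is
   only required to be continuous. *)
Definition trajectory (R : realType) (n m : nat) (i j : 'I_m -> 'I_n)
    (T : R) (u : 'I_m -> R -> R) (X : R -> 'M[R]_n) : Prop :=
  [/\ X 0 = 1%:M,
      {within `[0, T], continuous X},
      (forall s, s \in `[0, T] -> SO (X s)) &
      exists N (t : nat -> R), subdivision T N t /\
        forall a, (a < N)%N ->
          (exists c : 'I_m -> R, forall q s, s \in `]t a, t a.+1[ -> u q s = c q)
          /\ (forall s, s \in `]t a, t a.+1[ ->
                is_derive s 1 X ((\sum_q u q s *: Omega R (i q) (j q)) *m X s))].

Definition controllable_submanifold (R : realType) (n m : nat)
    (i j : 'I_m -> 'I_n) : set 'M[R]_n :=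
  [set Y | exists T u X, [/\ 0 <= T, trajectory i j T u X & X T = Y]].

Fixpoint class_C (R : realType) (V W : normedModType R) (k : nat)
    (U : set V) (f : V -> W) : Prop :=
  (forall x, U x -> {for x, continuous f}) /\
  if k is k'.+1 then
    forall v, (forall x, U x -> derivable f x v) /\
              class_C k' U (fun x => 'D_v f x)
  else True.

Definition smooth_on (R : realType) (V W : normedModType R)
    (U : set V) (f : V -> W) : Prop :=
  forall k, class_C k U f.

(* A local parametrization (an inverse chart); the values of [pmap] outside
   [pdom] are irrelevant. *)
Record parametrization (R : realType) (d n : nat) := Parametrization {
  pdom : set 'rV[R]_d;
  pmap :> 'rV[R]_d -> 'M[R]_n
}.

Definition immersive_param (R : realType) (d n : nat)
    (phi : parametrization R d n) : Prop :=
  [/\ open (pdom phi),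
      smooth_on (pdom phi) phi,
      {in pdom phi &, injective phi} &
      forall x, pdom phi x -> forall v, 'D_v phi x = 0 -> v = 0].

(* The overlap of the images is open on the [phi] side, and the transition map
   [psi^-1 \o phi] is smooth on it. *)
Definition compatible (R : realType) (d n : nat)
    (phi psi : parametrization R d n) : Prop :=
  let D := pdom phi `&` phi @^-1` (psi @` pdom psi) in
  open D /\
  exists g : 'rV[R]_d -> 'rV[R]_d,
    smooth_on D g /\ forall x, D x -> pdom psi (g x) /\ psi (g x) = phi x.

(* A structure of d-dimensional immersed submanifold on the subset [N] of the
   space of matrices.  Its manifold topology (see [manifold_open]) may be finer
   than the subspace topology; it is Hausdorff because the inclusion is
   continuous, and second countable as soon as it is connected. *)
Definition immersed_atlas (R : realType) (d n : nat) (N : set 'M[R]_n)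
    (atlas : set (parametrization R d n)) : Prop :=
  [/\ forall phi, atlas phi -> immersive_param phi,
      forall phi psi, atlas phi -> atlas psi -> compatible phi psi &
      N = \bigcup_(phi in atlas) (phi @` pdom phi)].

Definition manifold_open (R : realType) (d n : nat) (N : set 'M[R]_n)
    (atlas : set (parametrization R d n)) (W : set 'M[R]_n) : Prop :=
  W `<=` N /\ forall phi, atlas phi -> open (pdom phi `&` phi @^-1` W).

Definition manifold_connected (R : realType) (d n : nat) (N : set 'M[R]_n)
    (atlas : set (parametrization R d n)) : Prop :=
  N !=set0 /\
  forall W, manifold_open N atlas W -> manifold_open N atlas (N `\` W) ->
    W = set0 \/ W = N.

Definition connected_integral_manifold (R : realType) (n : nat)
    (Delta : 'M[R]_n -> {vspace 'M[R]_n}) (N : set 'M[R]_n) : Prop :=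
  N `<=` @SO R n /\
  exists d (atlas : set (parametrization R d n)),
    [/\ immersed_atlas N atlas,
        manifold_connected N atlas &
        forall phi, atlas phi -> forall x, pdom phi x ->
          forall w, (exists v, 'D_v phi x = w) <-> w \in Delta (phi x)].

Definition maximal_integral_manifold_through (R : realType) (n : nat)
    (Delta : 'M[R]_n -> {vspace 'M[R]_n}) (x0 : 'M[R]_n) (N : set 'M[R]_n) :
    Prop :=
  [/\ connected_integral_manifold Delta N,
      N x0 &
      forall N', connected_integral_manifold Delta N' -> N `<=` N' -> N' = N].

Definition Delta_orbit (R : realType) (n : nat) (O : {set 'I_n})
    (X : 'M[R]_n) : {vspace 'M[R]_n} :=
  <<[seq Omega R i j *m X | i <- enum O, j <- enum O]>>%VS.

(* The sum is direct at every point of SO(n) when the [O l] are pairwise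
   disjoint: see [Delta_sum_direct]. *)
Definition Delta_sum (R : realType) (n k : nat) (O : 'I_k -> {set 'I_n})
    (X : 'M[R]_n) : {vspace 'M[R]_n} :=
  (\sum_(l < k) Delta_orbit (O l) X)%VS.

Definition perm_class (n : nat) (s : 'S_n) : {set 'S_n} :=
  [set t : 'S_n | porbits s == porbits t]%SET.

Definition star (n : nat) (s : 'S_n) (p : 'I_n * 'I_n) : 'S_n :=
  if p.2 \in porbit s p.1 then s else (s * tperm p.1 p.2)%g.

Definition star_prod (n : nat) (l : seq ('I_n * 'I_n)) : 'S_n :=
  foldl (@star n) 1%g l.

(* Only the basis elements belonging to [F] matter.  They are listed in the
   order of [enum]; by [iota_tildeE] any other listing gives the same class. *)
Definition iota_tilde (R : realType) (n : nat) (F : set 'M[R]_n) : {set 'S_n} :=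
  perm_class (star_prod
    [seq p : 'I_n * 'I_n <- enum {: 'I_n * 'I_n} |
       (p.1 < p.2)%N && `[< F (Omega R p.1 p.2) >]]).

Definition cycle_with_orbit (n : nat) (s : 'S_n) (O : {set 'I_n}) : Prop :=
  [set A in porbits s | (1 < #|A|)%N]%SET = [set O]%SET.

Lemma Omega_inj (R : realType) (n : nat) (a b c d : 'I_n) :
  (a < b)%N -> (c < d)%N -> Omega R a b = Omega R c d -> (a, b) = (c, d).
Proof.
move=> ab cd /matrixP/(_ a b); rewrite !mxE !eqxx /=.
have -> : (a == b) = false by apply/eqP => e; rewrite e ltnn in ab.
have -> : (a == d) && (b == c) = false.
  by apply/negP => /andP[/eqP e1 /eqP e2]; move: cd; rewrite -e1 -e2 ltnNge ltnW.
rewrite !subr0; case: andP => [[/eqP-> /eqP->]//|_] /eqP.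
by rewrite oner_eq0.
Qed.

Lemma merge_trans (T : eqType) (A B : T) :
  let r U V := [|| V == U, (A == U) && (V == B) | (B == U) && (V == A)] in
  transitive r.
Proof.
move=> r V U W /=; rewrite /r.
case/or3P => [/eqP->//|/andP[/eqP<- /eqP->]|/andP[/eqP<- /eqP->]];
  case/or3P => [/eqP->|/andP[/eqP e /eqP->]|/andP[/eqP e /eqP->]];
  by rewrite ?e ?eqxx ?orbT.
Qed.

Lemma porbit_star (n : nat) (s : 'S_n) (p : 'I_n * 'I_n) (x y : 'I_n) :
  (y \in porbit (star s p) x) =
  [|| y \in porbit s x,
      (p.1 \in porbit s x) && (y \in porbit s p.2) |
      (p.2 \in porbit s x) && (y \in porbit s p.1)].
Proof.
case: p => a b /=; rewrite /star /=.
have E (t : 'S_n) u v : (u \in porbit t v) = (porbit t u == porbit t v).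
  by rewrite eq_porbit_mem.
have step (t : 'S_n) u : porbit t (t u) = porbit t u.
  by apply/eqP; rewrite eq_porbit_mem -{1}(expg1 t) mem_porbit.
case: ifPn => [|nab].
  rewrite !E => /eqP ->; rewrite orbb.
  by case: (porbit s a =P porbit s x) => [->|_]; rewrite ?orbb ?orbF.
set t := (s * tperm a b)%g.
have tE u : t u = tperm a b (s u) by rewrite permM.
have relx u : [|| porbit s (t u) == porbit s u,
  (porbit s a == porbit s u) && (porbit s (t u) == porbit s b) |
  (porbit s b == porbit s u) && (porbit s (t u) == porbit s a)].
  by rewrite tE -(step s u); case: tpermP => [->|->|_ _]; rewrite !eqxx ?orbT.
have ab : porbit t a = porbit t b.
  apply/eqP; rewrite eq_porbit_mem; apply/negPn/negP => nt.
  have h1 := porbits_mul_tperm t^-1 a b; have h2 := porbits_mul_tperm s^-1 a b.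
  move: h1 h2 => /=; rewrite !porbitV !porbitsV.
  have -> : (tperm a b * s^-1 = t^-1)%g by rewrite /t invMg tpermV.
  have -> : (tperm a b * t^-1 = s^-1)%g.
    by rewrite /t invMg tpermV mulgA tperm2 mul1g.
  have nab' : a \notin porbit s b by rewrite porbit_sym.
  have neq : a != b by apply: contraNneq nt => ->; exact: porbit_id.
  by rewrite !porbitsV nt nab' neq => /= h1 h2; lia.
have tp z : porbit t (tperm a b z) = porbit t z by case: tpermP => [->|->|].
have st u : porbit t (s u) = porbit t u by rewrite -tp -tE step.
have sub u v : porbit s v = porbit s u -> porbit t v = porbit t u.
  move=> /eqP; rewrite eq_porbit_mem => /porbitP[i ->].
  elim: i => [|i IH]; first by rewrite expg0 perm1.
  by rewrite expgSr permM st.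
apply/idP/idP.
  move=> /porbitP[i ->]; rewrite !E.
  elim: i => [|i IH]; first by rewrite expg0 perm1 eqxx.
  by apply: (merge_trans IH); rewrite expgSr permM.
rewrite !E => /or3P[/eqP/sub ->|/andP[/eqP/sub h /eqP/sub h']
                              |/andP[/eqP/sub h /eqP/sub h']] //.
  by rewrite h' -ab h.
by rewrite h' ab h.
Qed.

Lemma porbit_star_prod (n : nat) (l1 l2 : seq ('I_n * 'I_n)) :
  l1 =i l2 -> forall x, porbit (star_prod l1) x = porbit (star_prod l2) x.
Proof.
pose e (l : seq ('I_n * 'I_n)) : rel 'I_n :=
  fun x y => ((x, y) \in l) || ((y, x) \in l).
suff H l x y : (y \in porbit (star_prod l) x) = connect (e l) x y.
  move=> l12 x; apply/setP => y; rewrite !H; apply: eq_connect => u v.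
  by rewrite /e !l12.
have esym l' : connect_sym (e l').
  by apply: sym_connect_sym => u v; rewrite /e orbC.
elim/last_ind: l x y => [|l p IH] x y.
  rewrite /star_prod /=; apply/idP/idP => [/porbitP[q ->]|].
    by rewrite expg1n perm1 connect0.
  by move=> /connectP[[|z q] //= _ ->]; exact: porbit_id.
rewrite /star_prod foldl_rcons -/(star_prod l) porbit_star.
have sub u v : connect (e l) u v -> connect (e (rcons l p)) u v.
  apply: connect_sub => {}u {}v uv; apply: connect1; move: uv.
  by rewrite /e !mem_rcons !inE => /orP[->|->]; rewrite ?orbT.
have pp : connect (e (rcons l p)) p.1 p.2.
  by apply: connect1; rewrite /e -surjective_pairing mem_rcons mem_head.
apply/idP/idP.
  rewrite !IH => /or3P[/sub//|/andP[/sub h /sub h']|/andP[/sub h /sub h']].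
    exact: connect_trans (connect_trans h pp) h'.
  by rewrite esym in pp; exact: connect_trans (connect_trans h pp) h'.
case/connectP => q qp ->; rewrite -!eq_porbit_mem.
elim/last_ind: q qp => [|q z IHq] /=; first by rewrite eqxx.
rewrite rcons_path last_rcons => /andP[/IHq {IHq}]; set w := last x q.
move=> h ez; apply: (merge_trans h); move: ez.
rewrite /e !mem_rcons !inE -!orbA => /or4P[/eqP <-|E|/eqP <-|E] /=.
- by rewrite !eqxx orbT.
- by rewrite eq_porbit_mem IH connect1 // /e E.
- by rewrite !eqxx !orbT.
- by rewrite eq_porbit_mem IH connect1 // /e E orbT.
Qed.

Lemma iota_tildeE (R : realType) (n : nat) (l : seq ('I_n * 'I_n)) :
  (forall p, p \in l -> (p.1 < p.2)%N) ->
  iota_tilde [set Omega R p.1 p.2 | p in [set` l]] = perm_class (star_prod l).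
Proof.
move=> hl; rewrite /iota_tilde; set l' := [seq _ <- _ | _].
have ll' : l' =i l.
  move=> p; rewrite mem_filter mem_enum andbT; apply/andP/idP.
    case=> lp /asboolP[q /= ql]; rewrite [p]surjective_pairing => /Omega_inj <- //.
      by rewrite -surjective_pairing.
    exact: hl.
  by move=> pl; split; [exact: hl|apply/asboolP; exists p].
have pE : porbits (star_prod l') = porbits (star_prod l).
  by apply: eq_imset => x; exact: porbit_star_prod.
by apply/setP => t; rewrite !inE pE.
Qed.

Lemma Delta_orbitP (R : realType) (n : nat) (O : {set 'I_n}) (X w : 'M[R]_n) :
  w \in Delta_orbit O X ->
  exists2 A : 'M[R]_n, w = A *m X &
    forall a b, ~~ ((a \in O) && (b \in O)) -> A a b = 0.
Proof.
rewrite /Delta_orbit; set s := [seq _ | _ <- _, _ <- _] => ws.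
have /coord_span -> : w \in <<in_tuple s>>%VS by [].
have K (q : 'I_(size s)) : exists2 A : 'M[R]_n, s`_q = A *m X &
    forall a b, ~~ ((a \in O) && (b \in O)) -> A a b = 0.
  have /allpairsP[[i j] [/= iO jO ->]] := mem_nth 0 (ltn_ord q).
  exists (Omega R i j) => // a b nO; rewrite !mxE.
  rewrite !mem_enum in iO jO.
  have -> : (a == i) && (b == j) = false.
    by apply: contraNF nO => /andP[/eqP-> /eqP->]; rewrite iO jO.
  have -> : (a == j) && (b == i) = false.
    by apply: contraNF nO => /andP[/eqP-> /eqP->]; rewrite iO jO.
  by rewrite subr0.
elim/big_rec: _ => [|q v _ [A -> HA]]; first by exists 0; rewrite ?mul0mx // => *; rewrite mxE.
have [B BE HB] := K q; exists (coord (in_tuple s) q w *: B + A).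
  by rewrite mulmxDl -scalemxAl -BE.
by move=> a b nO; rewrite !mxE HB // HA // mulr0 addr0.
Qed.

Lemma Delta_sum_direct (R : realType) (n k : nat) (O : 'I_k -> {set 'I_n})
    (X : 'M[R]_n) :
  (forall l l', l != l' -> [disjoint O l & O l']%B) -> SO X ->
  directv (\sum_(l < k) Delta_orbit (O l) X)%VS.
Proof.
move=> dO [XX _]; apply/directv_sum_independent => us hus us0 l _.
have Xu : X \in unitmx by have := mulmx1_unit XX; case.
have H l' := Delta_orbitP (hus l' isT).
have /boolp.choice[A HA] : forall l', exists A : 'M[R]_n, us l' = A *m X /\
    forall a b, ~~ ((a \in O l') && (b \in O l')) -> A a b = 0.
  by move=> l'; case: (H l') => B; exists B.
have : (\sum_l' A l') *m X = 0.
  by rewrite mulmx_suml -[RHS]us0; apply: eq_bigr => l' _; case: (HA l').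
move=> /(congr1 (mulmx^~ (invmx X))); rewrite mulmxK // mul0mx => S0.
case: (HA l) => -> Al; suff -> : A l = 0 by rewrite mul0mx.
apply/matrixP => a b; rewrite mxE.
case: (boolP ((a \in O l) && (b \in O l))) => [/andP[aO bO]|]; last exact: Al.
have /matrixP/(_ a b) := S0; rewrite summxE mxE (bigD1 l) //= big1 ?addr0 //.
move=> l' ll'; case: (HA l') => _; apply; apply/negP => /andP[aO' _].
by have /disjointFr/(_ aO') := dO _ _ ll'; rewrite aO.
Qed.

(* Main.v *)
Require Import Defs.
From HB Require Import structures.
From mathcomp Require Import all_boot all_order all_algebra all_fingroup.
From mathcomp Require Import all_classical all_reals all_analysis.
From mathcomp Require Import ring.
Import Order.TTheory GRing.Theory Num.Theory.
Import numFieldNormedType.Exports.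
Set Implicit Arguments.
Unset Strict Implicit.
Unset Printing Implicit Defensive.
Local Open Scope classical_set_scope.
Local Open Scope ring_scope.

(** Why the theorem is true.

    Label the indices by the entries of a row d and let D be the diagonal matrix
    of these labels.  A matrix commutes with D exactly when it is block diagonal
    for the partition of the indices into sets of equal label, so the skew
    matrices commuting with D ([block_skew]) form the Lie algebra spanned by the
    Omega_ab with a, b in a common block.  The group [block_SO] generated by
    their Cayley transforms is the product of the rotation groups of the blocks.
    Everything reduces to two descriptions of such groups.

    The controllable set is [block_SO] for the partition into the orbits of the
    star product of the edges (i_q, j_q), see [controllable_block_SO].
    Upper bound: if X' = A X with A skew and commuting with D, then X^T D X is
    constant ([conserved_frame]), so a trajectory issued from 1 consists of
    orthogonal matrices commuting with D.  Two of these that are close to each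
    other differ by a Cayley transform, and the trajectory is connected, so it
    does not leave [block_SO] ([connected_block_SO]).
    Lower bound: switching on one control produces the rotations in the plane of
    one edge; a quarter turn in the plane (b, c) conjugates the plane (a, b) to
    (c, a), so the planes of all pairs in an orbit are obtained
    ([rotates_star_prod]); Givens reduction writes every special orthogonal
    matrix of a block as a product of such rotations ([givens_block]).

    The group [block_SO] for the partition into the O_l and singletons is the
    largest connected integral manifold of Delta through 1.  The maps
    A |-> cayley A *m g, for g in the group, are rational charts with rational
    inverses, and their tangent spaces are those of Delta
    ([block_SO_integral_manifold]).  Conversely, along a line in a chart of any
    integral manifold the same quantity X^T D X is conserved, so membership in
    [block_SO] is locally constant on the manifold ([integral_manifold_sub]).

    Hence the controllable set is the maximal integral manifold if and only if
    the two block rotation groups are equal.  A block rotation group determines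
    its partition ([block_SO_sub_label]), since the Cayley transform is an
    involution; so this means that the two permutations have the same orbits,
    which is the equality of their classes. *)

(** * Limits and derivatives of matrix-valued functions *)

Section MatrixCalculus.
Context {R : realType}.

(** The norm of a matrix is the maximum of the norms of its finitely many
    entries. *)
Lemma cvg_mxP {T : Type} (m n : nat) (F : set_system T) {FF : Filter F}
    (f : T -> 'M[R]_(m, n)) (M : 'M[R]_(m, n)) :
  f @ F --> M <-> forall a b, (fun x => f x a b) @ F --> M a b.
Proof.
split=> [fM a b|fM].
  exact: (cvg_comp f (fun N : 'M[R]_(m, n) => N a b) fM (@coord_continuous R m n a b M)).
apply/cvgrPdist_lt => /= e e0.
have : \forall x \near F, forall ab : 'I_m * 'I_n,
    `|M ab.1 ab.2 - f x ab.1 ab.2| < e.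
  by apply: filter_forall => -[a b] /=; move/cvgrPdist_lt: (fM a b); exact.
apply: filterS => x xe; rewrite /Num.Def.normr /= mx_normrE.
by apply: bigmax_lt => // -[a b] _; rewrite !mxE; exact: (xe (a, b)).
Qed.

Lemma is_derive_mxP {V : normedModType R} (m n : nat)
    (f : V -> 'M[R]_(m, n)) x v (df : 'M[R]_(m, n)) :
  is_derive x v f df <->
  forall a b, is_derive x v (fun y => f y a b) (df a b).
Proof.
split=> [[fx <-] a b|fx].
  by rewrite derive_mx // mxE; apply: DeriveDef => //; exact: (derivable_mxP _ _ _).1.
have dfx : derivable f x v.
  by apply/derivable_mxP => a b; have [] := fx a b.
apply: DeriveDef => //; rewrite derive_mx //; apply/matrixP => a b.
by rewrite mxE; have [] := fx a b.
Qed.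

Lemma cvg_mulmx {T : Type} (m n p : nat) (F : set_system T) {FF : Filter F}
    (f : T -> 'M[R]_(m, n)) (g : T -> 'M[R]_(n, p)) (M : 'M[R]_(m, n)) (N : 'M[R]_(n, p)) :
  f @ F --> M -> g @ F --> N -> (fun x => f x *m g x) @ F --> M *m N.
Proof.
move=> /cvg_mxP fM /cvg_mxP gN; apply/cvg_mxP => a b; rewrite mxE.
under eq_fun do rewrite mxE.
by apply: cvg_big => [|c _]; [exact: add_continuous|exact: cvgM].
Qed.

Lemma cvg_det {T : Type} (n : nat) (F : set_system T) {FF : Filter F}
    (f : T -> 'M[R]_n) (M : 'M[R]_n) :
  f @ F --> M -> (fun x => \det (f x)) @ F --> \det M.
Proof.
move=> /cvg_mxP fM; rewrite /determinant.
apply: cvg_big => [|s _]; first exact: add_continuous.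
apply: cvgM; first exact: cvg_cst.
by apply: cvg_big => [|a _]; [exact: mul_continuous|exact: fM].
Qed.

(** Near an invertible M the inverse is the adjugate divided by the
    determinant, whose entries are polynomials in the entries of the matrix.
    *)
Lemma cvg_invmx {T : Type} (n : nat) (F : set_system T) {FF : Filter F}
    (f : T -> 'M[R]_n) (M : 'M[R]_n) :
  M \in unitmx -> f @ F --> M -> (fun x => invmx (f x)) @ F --> invmx M.
Proof.
move=> uM fM; have dM : \det (f x) @[x --> F] --> \det M by exact: cvg_det.
have M0 : \det M != 0 by rewrite -unitfE -unitmxE.
have E x : \det (f x) != 0 -> (\det (f x))^-1 *: \adj (f x) = invmx (f x).
  by move=> fx0; rewrite /invmx unitmxE unitfE fx0.
apply: (@cvg_trans _ ((fun x => (\det (f x))^-1 *: \adj (f x)) @ F)).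
  by apply: near_eq_cvg; apply: filterS (cvgr_neq0 _ dM M0) => x /E.
rewrite /invmx uM; apply/cvg_mxP => a b; rewrite !mxE.
under eq_fun do rewrite !mxE.
apply: cvgM; first exact: cvgV.
rewrite /cofactor; apply: cvgM; first exact: cvg_cst.
apply: cvg_det; apply/cvg_mxP => c d; rewrite !mxE.
under eq_fun do rewrite !mxE.
exact: (cvg_mxP _ _).1.
Unshelve. all: by end_near. Qed.

Lemma is_derive_mulmx {V : normedModType R} (m n p : nat)
    (f : V -> 'M[R]_(m, n)) (g : V -> 'M[R]_(n, p)) x v df dg :
  is_derive x v f df -> is_derive x v g dg ->
  is_derive x v (fun y => f y *m g y) (df *m g x + f x *m dg).
Proof.
move=> /is_derive_mxP fx /is_derive_mxP gx; apply/is_derive_mxP => a b.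
have -> : (fun y => (f y *m g y) a b) =
    \sum_(c < n) (fun y => f y a c) * (fun y => g y c b).
  by apply/funext => y; rewrite mxE fct_sumE.
apply: is_derive_eq.
by rewrite !mxE -big_split /=; apply: eq_bigr => c _; rewrite addrC [g x c b *: _]mulrC.
Qed.

Lemma derivable_cvg {V W : normedModType R} (f : V -> W) x v :
  derivable f x v -> f (h *: v + x) @[h --> (0 : R)^'] --> f x.
Proof.
move=> /(derivable1P _ _ _).1 /derivable1_diffP /differentiable_continuous.
by move=> /continuous_withinNx; rewrite scale0r add0r.
Qed.

(** The difference quotient is that of f between the inverses at the two
    points, because N^-1 - M^-1 = - N^-1 (N - M) M^-1; this also yields
    differentiability. *)
Lemma is_derive_invmx {V : normedModType R} (n : nat)
    (f : V -> 'M[R]_n) x v df :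
  f x \in unitmx -> is_derive x v f df ->
  is_derive x v (fun y => invmx (f y)) (- (invmx (f x) *m df *m invmx (f x))).
Proof.
move=> ux [fx <-].
pose q := fun h : R => h^-1 *: (f (h *: v + x) - f x).
have fc := derivable_cvg fx.
have L : (fun h : R => h^-1 *: (invmx (f (h *: v + x)) - invmx (f x))) @ 0^'
    --> - (invmx (f x) *m 'D_v f x *m invmx (f x)).
  apply: (@cvg_trans _
    ((fun h => - (invmx (f (h *: v + x)) *m q h *m invmx (f x))) @ 0^')).
    apply: near_eq_cvg; near=> h.
    have uh : f (h *: v + x) \in unitmx.
      rewrite unitmxE unitfE; near: h; apply: (cvgr_neq0 _ (cvg_det fc)).
      by rewrite -unitfE -unitmxE.
    rewrite /q -scalemxAr -scalemxAl mulmxBr mulmxBl mulVmx // mul1mx.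
    by rewrite -mulmxA mulmxV // mulmx1 -scalerN opprB.
  apply: cvgN; apply: cvg_mulmx; last exact: cvg_cst.
  by apply: cvg_mulmx; [exact: cvg_invmx|exact: fx].
apply: DeriveDef; last exact: cvg_lim L.
by apply/cvg_ex; eexists; exact: L.
Unshelve. all: by end_near. Qed.

End MatrixCalculus.

(** * Closure properties of the classes C^k *)

Section Smoothness.
Context {R : realType}.

(** The definition of [class_C] mentions the total function 'D_v f, whose
    values off U are arbitrary; on an open U it suffices to exhibit any
    function that is the derivative there. *)
Lemma class_C_intro {V W : normedModType R} k (U : set V) (f : V -> W) :
  open U -> (forall x, U x -> {for x, continuous f}) ->
  (forall v, exists2 df, forall x, U x -> is_derive x v f (df x) &
                         class_C k U df) ->
  class_C k.+1 U f.
Proof.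
have ext l (g h : V -> W) : open U -> (forall x, U x -> g x = h x) ->
    class_C l U g -> class_C l U h.
  move=> oU; elim: l g h => [|l IH] g h gh [gc gd].
    split=> // x Ux; have := gc x Ux; rewrite /prop_for /continuous_at gh //.
    apply: cvg_trans; apply: near_eq_cvg.
    by apply: filterS (open_nbhs_nbhs (conj oU Ux)) => y /gh.
  have ghn x : U x -> \forall y \near x, g y = h y.
    by move=> Ux; apply: filterS (open_nbhs_nbhs (conj oU Ux)) => y /gh.
  split=> [x Ux|v].
    have := gc x Ux; rewrite /prop_for /continuous_at gh //.
    by apply: cvg_trans; apply: near_eq_cvg; exact: ghn.
  have [gdv gC] := gd v; split=> [x Ux|].
    by apply: near_eq_derivable (gdv x Ux); exact: ghn.
  by apply: IH gC => x Ux; apply: near_eq_derive; exact: ghn.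
move=> oU fc fd; split=> // v; have [df fdf dfC] := fd v; split=> [x /fdf[]//|].
by apply: ext dfC => // x /fdf[].
Qed.

Lemma class_C_continuous {V W : normedModType R} k (U : set V) (f : V -> W) x :
  class_C k U f -> U x -> {for x, continuous f}.
Proof. by case: k => [|k] [fc _]; exact: fc. Qed.

Lemma class_C_derive {V W : normedModType R} k (U : set V) (f : V -> W) v x :
  class_C k.+1 U f -> U x -> is_derive x v f ('D_v f x).
Proof. by move=> [_ /(_ v)[fd _]] Ux; apply: DeriveDef => //; exact: fd. Qed.

Lemma class_CS {V W : normedModType R} k (U : set V) (f : V -> W) :
  class_C k.+1 U f -> class_C k U f.
Proof.
elim: k f => [|k IH] f [fc fd]; split=> // v.
by have [fdv fC] := fd v; split=> //; exact: IH.
Qed.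

Lemma class_C_cst {V W : normedModType R} k (U : set V) (a : W) :
  class_C k U (fun=> a).
Proof.
elim: k a => [|k IH] a; first by split=> // x _; exact: cvg_cst.
split=> [x _|v]; first exact: cvg_cst.
split=> [x _|]; first exact: derivable_cst.
have -> : (fun x : V => 'D_v (fun=> a) x) = (fun=> 0).
  by apply/funext => x; exact: derive_cst.
exact: IH.
Qed.

Lemma class_CD {V W : normedModType R} k (U : set V) (f g : V -> W) :
  open U -> class_C k U f -> class_C k U g -> class_C k U (fun x => f x + g x).
Proof.
move=> oU; elim: k f g => [|k IH] f g fC gC.
  split=> // x Ux; apply: cvgD.
    exact: class_C_continuous fC Ux.
  exact: class_C_continuous gC Ux.
apply: class_C_intro => // [x Ux|v].
  apply: cvgD; first exact: class_C_continuous fC Ux.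
  exact: class_C_continuous gC Ux.
exists (fun x => 'D_v f x + 'D_v g x) => [x Ux|].
  have := class_C_derive v fC Ux; have := class_C_derive v gC Ux => ? ?.
  exact: is_deriveD.
by apply: IH; [case: fC => _ /(_ v)[]|case: gC => _ /(_ v)[]].
Qed.

Lemma cvg_mx_linear {T : Type} m n p q (F : set_system T) {FF : Filter F}
    (f : T -> 'M[R]_(m, n)) (L : {linear 'M[R]_(m, n) -> 'M[R]_(p, q)})
    (M : 'M[R]_(m, n)) :
  f @ F --> M -> L (f x) @[x --> F] --> L M.
Proof.
move=> /cvg_mxP fM; have E (N : 'M[R]_(m, n)) :
    L N = \sum_a \sum_b N a b *: L (delta_mx a b).
  rewrite {1}(matrix_sum_delta N) linear_sum; apply: eq_bigr => a _.
  by rewrite linear_sum; apply: eq_bigr => b _; rewrite linearZ.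
rewrite E; under eq_fun do rewrite E.
apply: cvg_big => [|a _]; first exact: add_continuous.
apply: cvg_big => [|b _]; first exact: add_continuous.
exact: cvgZr_tmp.
Qed.

Lemma mx_linear_continuous m n p q (L : {linear 'M[R]_(m, n) -> 'M[R]_(p, q)}) :
  continuous L.
Proof.
move=> M; exact: (@cvg_mx_linear _ _ _ _ _ (nbhs M) (nbhs_filter M) id L M
                    (@cvg_id _ (nbhs M))).
Qed.

Lemma is_derive_linear {V : normedModType R} m n p q (f : V -> 'M[R]_(m, n))
    (L : {linear 'M[R]_(m, n) -> 'M[R]_(p, q)}) x v df :
  is_derive x v f df -> is_derive x v (fun y => L (f y)) (L df).
Proof.
move=> [fx <-].
have H : (fun h : R => h^-1 *: (L (f (h *: v + x)) - L (f x))) @ 0^'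
    --> L ('D_v f x).
  under eq_fun do rewrite -linearB -linearZ.
  exact: cvg_mx_linear.
apply: DeriveDef; last exact: cvg_lim H.
by apply/cvg_ex; eexists; exact: H.
Qed.

Lemma class_C_comp_linear {V : normedModType R} m n p q k (U : set V)
    (f : V -> 'M[R]_(m, n)) (L : {linear 'M[R]_(m, n) -> 'M[R]_(p, q)}) :
  open U -> class_C k U f -> class_C k U (fun x => L (f x)).
Proof.
move=> oU; elim: k f => [|k IH] f fC.
  split=> [x Ux|//].
  have fx : f y @[y --> x] --> f x := class_C_continuous fC Ux.
  exact: cvg_mx_linear.
apply: (class_C_intro oU) => [x Ux|v].
  have fx : f y @[y --> x] --> f x := class_C_continuous fC Ux.
  exact: cvg_mx_linear.
exists (fun x => L ('D_v f x)) => [x Ux|].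
  by apply: is_derive_linear; exact: class_C_derive fC Ux.
by apply: IH; case: fC => _ /(_ v)[].
Qed.

Lemma class_C_id {V : normedModType R} k (U : set V) :
  open U -> class_C k U (@id V).
Proof.
move=> oU; case: k => [|k]; first by split=> // x _; exact: cvg_id.
apply: class_C_intro => // [x _|v]; first exact: cvg_id.
by exists (fun=> v); [move=> x _; exact: is_derive_id|exact: class_C_cst].
Qed.

(** Induction on k: the product rule expresses the derivative by products of
    functions of class C^k. *)
Lemma class_C_mulmx {V : normedModType R} m n p k (U : set V)
    (f : V -> 'M[R]_(m, n)) (g : V -> 'M[R]_(n, p)) :
  open U -> class_C k U f -> class_C k U g -> class_C k U (fun x => f x *m g x).
Proof.
move=> oU; elim: k f g => [|k IH] f g fC gC.
  split=> [x Ux|//].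
  have fx : f y @[y --> x] --> f x := class_C_continuous fC Ux.
  have gx : g y @[y --> x] --> g x := class_C_continuous gC Ux.
  exact: cvg_mulmx.
apply: (class_C_intro oU) => [x Ux|v].
  have fx : f y @[y --> x] --> f x := class_C_continuous fC Ux.
  have gx : g y @[y --> x] --> g x := class_C_continuous gC Ux.
  exact: cvg_mulmx.
exists (fun x => 'D_v f x *m g x + f x *m 'D_v g x) => [x Ux|].
  by apply: is_derive_mulmx; [exact: class_C_derive fC Ux|exact: class_C_derive gC Ux].
have dfC : class_C k U (fun x => 'D_v f x) by case: fC => _ /(_ v)[].
have dgC : class_C k U (fun x => 'D_v g x) by case: gC => _ /(_ v)[].
exact: (class_CD oU (IH _ _ dfC (class_CS gC)) (IH _ _ (class_CS fC) dgC)).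
Qed.

(** Induction on k: the derivative of the inverse is a product of f', which is
    of class C^k, and of the inverse itself, which is so by induction. *)
Lemma class_C_invmx {V : normedModType R} n k (U : set V) (f : V -> 'M[R]_n) :
  open U -> (forall x, U x -> f x \in unitmx) ->
  class_C k U f -> class_C k U (fun x => invmx (f x)).
Proof.
move=> oU uf; elim: k => [|k IH] fC.
  split=> [x Ux|//].
  have fx : f y @[y --> x] --> f x := class_C_continuous fC Ux.
  by apply: cvg_invmx => //; exact: uf.
apply: (class_C_intro oU) => [x Ux|v].
  have fx : f y @[y --> x] --> f x := class_C_continuous fC Ux.
  by apply: cvg_invmx => //; exact: uf.
exists (fun x => - (invmx (f x) *m 'D_v f x *m invmx (f x))) => [x Ux|].
  by apply: is_derive_invmx; [exact: uf|exact: class_C_derive fC Ux].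
have iC := IH (class_CS fC).
apply: (@class_C_comp_linear _ _ _ _ _ _ _ _ -%R oU).
have dC : class_C k U (fun x => 'D_v f x) by case: fC => _ /(_ v)[].
exact: (class_C_mulmx oU (class_C_mulmx oU iC dC) iC).
Qed.

End Smoothness.

(** * Cayley transform and block rotation groups *)

Section BlockGroup.
Context {R : realType} {n : nat}.
Implicit Types (A X Y Q : 'M[R]_n) (d : 'rV[R]_n) (S : set 'M[R]_n).

(** No inverses are added, so S has to be stable under transposition for the
    words in orthogonal matrices to form a group. *)
Inductive generated S : 'M[R]_n -> Prop :=
| generated1 : generated S 1%:M
| generatedM X Y : S X -> generated S Y -> generated S (X *m Y).

Lemma generated_mem S X : S X -> generated S X.
Proof. by move=> SX; rewrite -[X]mulmx1; apply: generatedM => //; exact: generated1. Qed.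

Lemma generated_mul S X Y :
  generated S X -> generated S Y -> generated S (X *m Y).
Proof.
by move=> + GY; elim=> [|{}X Z SX _ IH]; rewrite ?mul1mx // -mulmxA; exact: generatedM.
Qed.

Lemma generated_sub S S' X :
  (forall Y, S Y -> generated S' Y) -> generated S X -> generated S' X.
Proof.
move=> SS'; elim=> [|{}X Y SX _ IH]; first exact: generated1.
by apply: generated_mul IH; exact: SS'.
Qed.

Lemma generated_tr S X :
  (forall Y, S Y -> S Y^T) -> generated S X -> generated S X^T.
Proof.
move=> St; elim=> [|{}X Y SX _ IH]; first by rewrite trmx1; exact: generated1.
by rewrite trmx_mul; apply: generated_mul IH _; apply: generated_mem; exact: St.
Qed.

(** The diagonal of K K^T consists of sums of squares. *)
Lemma mulmx_tr_eq0 m p (K : 'M[R]_(m, p)) : K *m K^T = 0 -> K = 0.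
Proof.
move=> /matrixP K0; apply/matrixP => a b; rewrite mxE.
have := K0 a a; rewrite !mxE => /eqP; rewrite psumr_eq0.
  by move=> /allP/(_ b (mem_index_enum _)) /=; rewrite mxE -expr2 sqrf_eq0 => /eqP.
by move=> c _; rewrite mxE -expr2 sqr_ge0.
Qed.

Lemma unitmx_1D1 : 1%:M + 1%:M \in @unitmx R n.
Proof. by rewrite -mulr2n -scaler_nat unitmxZ ?unitmx1 // unitfE pnatr_eq0. Qed.

(** If K (1 + A) = 0, then K K^T = - K A K^T is both symmetric and skew, hence
    zero. *)
Lemma skew_unit A : A^T = - A -> 1%:M + A \in unitmx.
Proof.
move=> At; rewrite -row_free_unit -kermx_eq0.
move: (kermx _) (mulmx_ker (1%:M + A)) => K K0.
have E : K *m K^T + K *m A *m K^T = 0.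
  by rewrite -mulmxDl -{1}[K]mulmx1 -mulmxDr K0 mul0mx.
have E' : K *m K^T - K *m A *m K^T = 0.
  by rewrite -[RHS](trmx0 R) -E [RHS]linearD /= !trmx_mul trmxK At mulNmx mulmxN mulmxA.
apply/eqP/mulmx_tr_eq0; have := congr2 +%R E E'.
rewrite addrACA subrr !addr0 -mulr2n -scaler_nat => /eqP.
by rewrite scaler_eq0 pnatr_eq0 /= => /eqP.
Qed.

Lemma mulmx_inv2 (A B C : 'M[R]_n) :
  A \in unitmx -> B \in unitmx -> A *m C *m B = A + B ->
  C = invmx A + invmx B.
Proof.
move=> uA uB /(congr1 (fun M => invmx A *m M *m invmx B)).
rewrite -!mulmxA mulmxV // mulmx1 mulKmx // => ->.
by rewrite mulmxDl mulmxDr mulmxV // mulmx1 mulKmx // addrC.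
Qed.

(** This is (1 - A) (1 + A)^-1, see [cayleyE], in the form that is simplest to
    differentiate. *)
Definition cayley A : 'M[R]_n := 2 *: invmx (1%:M + A) - 1%:M.

Lemma cayleyE A : 1%:M + A \in unitmx ->
  cayley A = (1%:M - A) *m invmx (1%:M + A).
Proof.
move=> uA; have -> : 1%:M - A = 2 *: 1%:M - (1%:M + A).
  by rewrite scaler_nat mulr2n opprD addrA addrK.
by rewrite mulmxBl mulmxV // -scalemxAl mul1mx.
Qed.

Lemma cayley_tr A : (cayley A)^T = cayley A^T.
Proof. by rewrite /cayley linearB /= linearZ /= trmx1 trmx_inv linearD /= trmx1. Qed.

(** 1 + cayley A is twice the inverse of 1 + A; for the same reason the
    transform is an involution. *)
Lemma cayley_unit A : 1%:M + A \in unitmx -> 1%:M + cayley A \in unitmx.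
Proof.
move=> uA; rewrite /cayley addrC subrK unitmxZ ?unitmx_inv //.
by rewrite unitfE pnatr_eq0.
Qed.

Lemma cayleyK A : 1%:M + A \in unitmx -> cayley (cayley A) = A.
Proof.
move=> uA; rewrite {1}/cayley [1%:M + cayley A]addrC /cayley subrK.
rewrite invmxZ ?unitmx_inv //; last by rewrite unitmxZ ?unitmx_inv // unitfE pnatr_eq0.
by rewrite invmxK scalerA divff ?pnatr_eq0 // scale1r addrC addKr.
Qed.

Lemma cayley_skew_orth A : A^T = - A -> (cayley A)^T *m cayley A = 1%:M.
Proof.
move=> At; have uA := skew_unit At.
have uA' : 1%:M - A \in unitmx by rewrite -At -(trmx1 R n) -linearD /= unitmx_tr.
rewrite cayley_tr At cayleyE // cayleyE // opprK !mulmxA.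
rewrite -[(1%:M + A) *m _ *m _]mulmxA mulVmx // mulmx1 mulmxV //.
Qed.

(** 1 - A is the transpose of 1 + A. *)
Lemma cayley_skew_det A : A^T = - A -> \det (cayley A) = 1.
Proof.
move=> At; have uA := skew_unit At.
rewrite cayleyE // det_mulmx det_inv -det_tr linearB /= trmx1 At opprK.
by rewrite mulfV // -unitfE -unitmxE.
Qed.

(** Skewness amounts to (1 + Q^T)^-1 + (1 + Q)^-1 = 1, and multiplying out
    both sides reduces this to Q^T Q = 1. *)
Lemma cayley_orth_skew Q : Q^T *m Q = 1%:M -> 1%:M + Q \in unitmx ->
  (cayley Q)^T = - cayley Q.
Proof.
move=> Qo uQ; have uQ' : 1%:M + Q^T \in unitmx.
  by rewrite -(trmx1 R n) -linearD /= unitmx_tr.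
apply/eqP; rewrite -addr_eq0 cayley_tr /cayley addrACA -scalerDr.
rewrite -(@mulmx_inv2 (1%:M + Q^T) (1%:M + Q) 1%:M) //.
  by rewrite scaler_nat mulr2n -opprD subrr.
rewrite mulmx1 mulmxDr mulmx1 mulmxDl Qo mul1mx.
by rewrite -addrA addrA [Q + 1%:M]addrC.
Qed.

Lemma comm_mxZ B A (c : R) : comm_mx B A -> comm_mx B (c *: A).
Proof. by rewrite /comm_mx -scalemxAr -scalemxAl => ->. Qed.

Lemma comm_mxV B A : A \in unitmx -> comm_mx B A -> comm_mx B (invmx A).
Proof.
move=> uA cBA; rewrite /comm_mx -[B in LHS](mulKmx uA) -cBA -!mulmxA.
by rewrite mulmxV // mulmx1.
Qed.

Lemma comm_mx_cayley B A : 1%:M + A \in unitmx -> comm_mx B A ->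
  comm_mx B (cayley A).
Proof.
move=> uA cBA; apply: comm_mxB; last exact: comm_mx1.
by apply: comm_mxZ; apply: comm_mxV => //; apply: comm_mxD => //; exact: comm_mx1.
Qed.

Lemma cayley0 : cayley 0 = 1%:M :> 'M[R]_n.
Proof. by rewrite /cayley addr0 invmx1 scaler_nat mulr2n addrK. Qed.

Lemma invmxM A B : A \in unitmx -> B \in unitmx ->
  invmx (A *m B) = invmx B *m invmx A.
Proof.
move=> uA uB; have uAB : A *m B \in unitmx by rewrite unitmx_mul uA.
rewrite -[RHS]mulmx1 -(mulmxV uAB) mulmxA -[_ *m (A *m B)]mulmxA.
by rewrite mulKmx // mulVmx // mul1mx.
Qed.

(** 1 + A + B and 1 - A - B factor as (1 + B) (1 + A) and (1 - A) (1 - B), and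
    all these factors commute. *)
Lemma cayleyD A B : A^T = - A -> B^T = - B -> A *m B = 0 -> B *m A = 0 ->
  cayley (A + B) = cayley A *m cayley B.
Proof.
move=> At Bt AB BA; have uA := skew_unit At; have uB := skew_unit Bt.
have eD : 1%:M + (A + B) = (1%:M + B) *m (1%:M + A).
  by rewrite mulmxDl mul1mx mulmxDr mulmx1 BA addr0 addrA.
have eB : 1%:M - (A + B) = (1%:M - A) *m (1%:M - B).
  by rewrite mulmxBl mul1mx mulmxBr mulmx1 AB subr0 opprD addrA addrAC.
have uAB : 1%:M + (A + B) \in unitmx by rewrite eD unitmx_mul uB.
have c : comm_mx (1%:M - B) (invmx (1%:M + A)).
  apply: comm_mxV => //; apply: comm_mxD; first exact: comm_mx1.
  apply: comm_mx_sym; apply: comm_mxB; first exact: comm_mx1.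
  by rewrite /comm_mx AB BA.
rewrite !cayleyE // eB eD -!mulmxA; congr (_ *m _).
rewrite [RHS]mulmxA -c -mulmxA; congr (_ *m _).
by rewrite invmxM.
Qed.

(** Block diagonal means here that A vanishes between indices with different
    labels in d, see [comm_diag_mxP]. *)
Definition block_skew d : set 'M[R]_n :=
  [set A | A^T = - A /\ comm_mx (diag_mx d) A].

Definition block_orth d : set 'M[R]_n :=
  [set X | X^T *m X = 1%:M /\ comm_mx (diag_mx d) X].

Definition block_SO d : set 'M[R]_n :=
  generated [set cayley A | A in block_skew d].

Lemma comm_diag_mxP d A : comm_mx (diag_mx d) A <->
  forall a b, d 0 a != d 0 b -> A a b = 0.
Proof.
rewrite /comm_mx mul_diag_mx mul_mx_diag; split=> [/matrixP E a b dab|A0].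
  have := E a b; rewrite !mxE mulrC => /eqP; rewrite -subr_eq0 -mulrBr mulf_eq0.
  by rewrite subr_eq0 (negbTE dab) orbF => /eqP.
apply/matrixP => a b; rewrite !mxE.
by have [->|/A0->] := eqVneq (d 0 a) (d 0 b); rewrite ?mulr0 ?mul0r // mulrC.
Qed.

Lemma orth_tr X : X^T *m X = 1%:M -> X *m X^T = 1%:M.
Proof. exact: mulmx1C. Qed.

Lemma comm_diag_tr d X : comm_mx (diag_mx d) X -> comm_mx (diag_mx d) X^T.
Proof. by move=> /(congr1 trmx); rewrite !trmx_mul tr_diag_mx. Qed.

Lemma block_orth1 d : block_orth d 1%:M.
Proof. by split; [rewrite trmx1 mulmx1|exact: comm_mx1]. Qed.

Lemma block_orth_mul d X Y : block_orth d X -> block_orth d Y ->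
  block_orth d (X *m Y).
Proof.
move=> [Xo Xd] [Yo Yd]; split; last exact: comm_mxM.
by rewrite trmx_mul -mulmxA (mulmxA X^T) Xo mul1mx.
Qed.

Lemma block_orth_tr d X : block_orth d X -> block_orth d X^T.
Proof. by move=> [Xo Xd]; split; [rewrite trmxK orth_tr|exact: comm_diag_tr]. Qed.

Lemma block_orth_cayley d A : block_skew d A -> block_orth d (cayley A).
Proof.
move=> [At Ad]; split; first exact: cayley_skew_orth.
by apply: comm_mx_cayley => //; exact: skew_unit.
Qed.

Lemma block_skew_cayley d Q : block_orth d Q -> 1%:M + Q \in unitmx ->
  block_skew d (cayley Q).
Proof.
by move=> [Qo Qd] uQ; split; [exact: cayley_orth_skew|exact: comm_mx_cayley].
Qed.

Lemma block_SO_orth d X : block_SO d X -> block_orth d X.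
Proof.
elim=> [|{}X Y [A Ad <-] _ IH]; first exact: block_orth1.
by apply: block_orth_mul IH; exact: block_orth_cayley.
Qed.

Lemma block_SO_sub d : block_SO d `<=` @SO R n.
Proof.
move=> X GX; split; first by have [] := block_SO_orth GX.
elim: GX => [|{}X Y [A [At _] <-] _ IH]; first exact: det1.
by rewrite det_mulmx IH mulr1 cayley_skew_det.
Qed.

Lemma block_SO_cayley d A : block_skew d A -> block_SO d (cayley A).
Proof. by move=> Ad; apply: generated_mem; exists A. Qed.

(** Such a Q, for instance any Q close to 1, is the Cayley transform of its
    own Cayley transform, which is skew; so close block orthogonal matrices
    belong to the group together. *)
Lemma block_SO_step d Q X : block_orth d Q -> 1%:M + Q \in unitmx ->
  block_SO d X -> block_SO d (Q *m X).
Proof.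
move=> Qd uQ; rewrite -(cayleyK uQ); apply: generated_mul; apply: block_SO_cayley.
exact: block_skew_cayley.
Qed.

Lemma block_SO_near d X Y : block_orth d X -> block_orth d Y ->
  1%:M + Y *m X^T \in unitmx -> block_SO d X -> block_SO d Y.
Proof.
move=> Xd Yd u GX; have Q := block_orth_mul Yd (block_orth_tr Xd).
have -> : Y = (Y *m X^T) *m X by rewrite -mulmxA (Xd.1) mulmx1.
exact: block_SO_step.
Qed.

End BlockGroup.

(** * Plane rotations *)

Section Rotations.
Context {R : realType} {n : nat}.
Implicit Types (W X Y Q P : 'M[R]_n) (a b c : 'I_n) (t : R).

(** The Rodrigues form of exp(t W), valid when W^3 = - W. *)
Definition rotation W t : 'M[R]_n :=
  1%:M + sin t *: W + (1 - cos t) *: (W *m W).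

Lemma rotation0 W : rotation W 0 = 1%:M.
Proof. by rewrite /rotation sin0 cos0 subrr !scale0r !addr0. Qed.

Lemma rotationN W t : rotation (- W) t = rotation W (- t).
Proof. by rewrite /rotation sinN cosN mulNmx mulmxN opprK scalerN scaleNr. Qed.

Lemma rotation_tr W t : W^T = - W -> (rotation W t)^T = rotation W (- t).
Proof.
move=> Wt; rewrite -rotationN /rotation !linearD /= !linearZ /= trmx1 trmx_mul.
by rewrite Wt.
Qed.

Lemma rotation_conj W P t : P *m P^T = 1%:M ->
  P *m rotation W t *m P^T = rotation (P *m W *m P^T) t.
Proof.
move=> Po; rewrite /rotation !mulmxDr !mulmxDl mulmx1 Po -!scalemxAr -!scalemxAl.
by rewrite !mulmxA -[_ *m P^T *m P]mulmxA (mulmx1C Po) mulmx1.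
Qed.

(** All powers of W reduce to 1, W and W^2 by W^3 = - W; what remains are the
    addition formulas. *)
Lemma rotationD W t u : W *m W *m W = - W ->
  rotation W t *m rotation W u = rotation W (t + u).
Proof.
move=> W3; rewrite /rotation sinD cosD !mulmxDl !mulmxDr !mul1mx !mulmx1.
rewrite -!scalemxAl -!scalemxAr !scalerA !mulmxA W3 mulNmx !scalerN.
apply/matrixP => a b; rewrite !mxE; ring.
Qed.

(** Differentiating gives cos t W + sin t W^2, and W^3 = - W turns W times the
    rotation into the same expression. *)
Lemma is_derive_rotation W t : W *m W *m W = - W ->
  is_derive t 1 (rotation W) (W *m rotation W t).
Proof.
move=> W3; have E : W *m rotation W t = cos t *: W + sin t *: (W *m W).
  rewrite /rotation !mulmxDr mulmx1 -!scalemxAr mulmxA W3.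
  by apply/matrixP => a b; rewrite !mxE; ring.
rewrite E; apply/is_derive_mxP => a b.
have -> : (fun t => rotation W t a b) =
    (fun t => (1%:M : 'M[R]_n) a b + (W *m W) a b + W a b *: sin t
               - (W *m W) a b *: cos t).
  apply/funext => u; rewrite /rotation.
  by move: (W *m W) => W2; rewrite !mxE /GRing.scale /=; ring.
move: (W *m W) => W2.
have ds := is_deriveZ (W a b) (is_derive_sin t).
have dc := is_deriveZ (W2 a b) (is_derive_cos t).
have d1 := is_derive_cst ((1%:M : 'M[R]_n) a b + W2 a b) t (1 : R).
apply: is_derive_eq (is_deriveB (is_deriveD d1 ds) dc) _.
by rewrite !mxE /GRing.scale /=; ring.
Qed.

Lemma Omega_tr a b : (Omega R a b)^T = - Omega R a b.
Proof. by rewrite /Omega linearB /= !trmx_delta opprB. Qed.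

Lemma OmegaN a b : Omega R b a = - Omega R a b.
Proof. by rewrite /Omega opprB. Qed.

Lemma Omega_sqr a b : a != b ->
  Omega R a b *m Omega R a b = - (delta_mx a a + delta_mx b b).
Proof.
move=> ab; rewrite /Omega mulmxBl !mulmxBr !mul_delta_mx_cond !eqxx.
by rewrite [b == a]eq_sym (negbTE ab) !mulr0n !mulr1n subr0 sub0r opprD addrC.
Qed.

Lemma Omega_cube a b : a != b ->
  Omega R a b *m Omega R a b *m Omega R a b = - Omega R a b.
Proof.
move=> ab; rewrite Omega_sqr // mulNmx; congr (- _).
rewrite /Omega mulmxDl !mulmxBr !mul_delta_mx_cond !eqxx.
by rewrite [b == a]eq_sym (negbTE ab) !mulr0n !mulr1n subr0 sub0r.
Qed.

(** The quarter turn fixes e_a and sends e_b to - e_c, so it carries e_a e_b^T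
    - e_b e_a^T to e_c e_a^T - e_a e_c^T. *)
Lemma Omega_quarter_turn a b c : a != b -> a != c -> b != c ->
  let P := rotation (Omega R b c) (pi / 2) in
  P *m Omega R a b *m P^T = Omega R c a.
Proof.
move=> ab ac bc P; rewrite rotation_tr ?Omega_tr // /P /rotation.
rewrite cosN sinN cos_pihalf sin_pihalf subr0 !scaleN1r !scale1r Omega_sqr //.
rewrite /Omega !(mulmxDl, mulmxBl, mulmxDr, mulmxBr, mulNmx, mulmxN, mul1mx, mulmx1).
have [ba ca cb] : [/\ b != a, c != a & c != b] by split; rewrite eq_sym.
do 2?rewrite !mul_delta_mx_cond ?eqxx ?(negbTE ab) ?(negbTE ac) ?(negbTE bc)
  ?(negbTE ba) ?(negbTE ca) ?(negbTE cb) ?mulr0n ?mulr1n ?mul0mx.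
by apply/matrixP => i j; rewrite !mxE; ring.
Qed.

Lemma block_skew_Omega (d : 'rV[R]_n) a b : d 0 a = d 0 b ->
  block_skew d (Omega R a b).
Proof.
move=> dab; split; first exact: Omega_tr.
apply/comm_diag_mxP => x y dxy; rewrite !mxE.
have -> : (x == a) && (y == b) = false.
  by apply: contraNF dxy => /andP[/eqP-> /eqP->]; rewrite dab.
have -> : (x == b) && (y == a) = false.
  by apply: contraNF dxy => /andP[/eqP-> /eqP->]; rewrite dab.
by rewrite subr0.
Qed.

Lemma rotation_orth W t : W^T = - W -> W *m W *m W = - W ->
  (rotation W t)^T *m rotation W t = 1%:M.
Proof. by move=> Wt W3; rewrite rotation_tr // rotationD // addNr rotation0. Qed.

(** The rotation by t is the square of the rotation by t / 2, whose
    determinant is 1 or - 1. *)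
Lemma rotation_det W t : W^T = - W -> W *m W *m W = - W ->
  \det (rotation W t) = 1.
Proof.
move=> Wt W3; rewrite [t]splitr -rotationD // det_mulmx.
have := congr1 determinant (rotation_orth (t / 2) Wt W3).
by rewrite det_mulmx det_tr det1.
Qed.

Lemma Omega_rotation_skew a b : a != b ->
  (Omega R a b)^T = - Omega R a b /\
  Omega R a b *m Omega R a b *m Omega R a b = - Omega R a b.
Proof. by move=> ab; split; [exact: Omega_tr|exact: Omega_cube]. Qed.

Definition supported_on (T : {set 'I_n}) Q :=
  forall a b, ~~ ((a \in T) && (b \in T)) -> Q a b = (a == b)%:R.

Lemma supported_mul (T : {set 'I_n}) P Q :
  supported_on T P -> supported_on T Q -> supported_on T (P *m Q).
Proof.
move=> sP sQ a b; rewrite negb_and => /orP[aT|bT]; rewrite mxE.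
  rewrite (bigD1 a) //= big1 => [|c ca].
    by rewrite sP ?negb_and ?aT // eqxx mul1r addr0 sQ // negb_and aT.
  by rewrite sP ?negb_and ?aT // eq_sym (negbTE ca) mul0r.
rewrite (bigD1 b) //= big1 => [|c cb].
  by rewrite [Q _ _]sQ ?negb_and ?bT ?orbT // eqxx mulr1 addr0 sP // negb_and bT orbT.
by rewrite [Q _ _]sQ ?negb_and ?bT ?orbT // (negbTE cb) mulr0.
Qed.

Lemma supported_rotation (T : {set 'I_n}) a b t :
  a \in T -> b \in T -> supported_on T (rotation (Omega R a b) t).
Proof.
move=> aT bT; have [<-|ab] := eqVneq a b.
  move=> c e _; rewrite /rotation /Omega subrr mulmx0 !scaler0 !addr0 mxE.
  by case: eqP.
move=> c e ce; rewrite /rotation Omega_sqr // !mxE.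
have H x y : x \in T -> y \in T -> (c == x) && (e == y) = false.
  by move=> xT yT; apply: contraNF ce => /andP[/eqP-> /eqP->]; rewrite xT.
by rewrite !H // !(subr0, addr0, oppr0, mulr0).
Qed.

End Rotations.

Section Givens.
Context {R : realType} {n : nat}.
Variable S : set 'M[R]_n.

Definition rotates (a b : 'I_n) := forall t, generated S (rotation (Omega R a b) t).

Lemma rotates_refl a : rotates a a.
Proof.
move=> t; rewrite /rotation /Omega subrr mulmx0 !scaler0 !addr0.
exact: generated1.
Qed.

Lemma rotates_sym a b : rotates a b -> rotates b a.
Proof. by move=> ab t; rewrite OmegaN rotationN. Qed.

(** Conjugation by a quarter turn in the plane (b, c) carries rotations of (a,
    b) to rotations of (c, a). *)
Lemma rotates_trans b a c : rotates a b -> rotates b c -> rotates a c.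
Proof.
move=> ab bc; have [->//|nab] := eqVneq a b.
have [<-|nac] := eqVneq a c; first exact: rotates_refl.
have [<-//|nbc] := eqVneq b c.
apply: rotates_sym => t; rewrite -(Omega_quarter_turn nab nac nbc).
have [Wt W3] := Omega_rotation_skew (R := R) nbc.
rewrite -rotation_conj; last by apply: orth_tr; exact: rotation_orth.
rewrite rotation_tr //; apply: generated_mul; last exact: bc.
by apply: generated_mul; [exact: bc|exact: ab].
Qed.

End Givens.

(** * Givens reduction of a block *)

Section GivensReduction.
Context {R : realType} {n : nat}.
Variable S : set 'M[R]_n.
Hypothesis S_tr : forall X, S X -> S X^T.
Implicit Types (Q g : 'M[R]_n) (a b c : 'I_n) (T : {set 'I_n}).

Definition block_word T g :=
  [/\ generated S g, supported_on T g, g^T *m g = 1%:M & \det g = 1].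

Lemma block_word1 T : block_word T 1%:M.
Proof.
split; rewrite ?trmx1 ?mulmx1 ?det1 //; first exact: generated1.
by move=> a b _; rewrite mxE.
Qed.

Lemma block_word_mul T g h : block_word T g -> block_word T h -> block_word T (g *m h).
Proof.
move=> [Sg Tg og dg] [Sh Th oh dh]; split.
- exact: generated_mul.
- exact: supported_mul.
- by rewrite trmx_mul -mulmxA (mulmxA g^T) og mul1mx.
- by rewrite det_mulmx dg dh mulr1.
Qed.

Lemma block_word_rotation T a b t : a != b -> rotates S a b -> a \in T -> b \in T ->
  block_word T (rotation (Omega R a b) t).
Proof.
move=> ab Sab aT bT; have [Wt W3] := Omega_rotation_skew (R := R) ab.
by split; [exact: Sab|exact: supported_rotation|exact: rotation_orth|exact: rotation_det].
Qed.

Lemma delta_col a b (v : 'cV[R]_n) : delta_mx a b *m v = v b 0 *: delta_mx a 0.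
Proof.
apply/matrixP => c z; rewrite (ord1 z) !mxE (bigD1 b) //= big1 => [|e eb].
  by rewrite mxE !eqxx !andbT addr0 mulrC.
by rewrite mxE (negbTE eb) andbF mul0r.
Qed.

Lemma rotation_col a b t (v : 'cV[R]_n) : a != b ->
  rotation (Omega R a b) t *m v =
  v + (cos t * v a 0 - v a 0 + sin t * v b 0) *: delta_mx a 0
    + (cos t * v b 0 - v b 0 - sin t * v a 0) *: delta_mx b 0.
Proof.
move=> ab; rewrite /rotation Omega_sqr // /Omega.
rewrite !mulmxDl mul1mx -!scalemxAl mulNmx !mulmxDl mulNmx !delta_col.
apply/matrixP => c z; rewrite !mxE; ring.
Qed.

(** Take arctan (y / x), or a quarter turn if x = 0: rotating (x, y) backwards
    by this angle annihilates its second coordinate. *)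
Lemma exists_killing_angle (x y : R) : exists t, cos t * y = sin t * x.
Proof.
have [->|x0] := eqVneq x 0.
  by exists (pi / 2); rewrite cos_pihalf mul0r mulr0.
exists (atan (y / x)).
have c0 : cos (atan (y / x)) != 0.
  by rewrite cos_atan invr_eq0 gt_eqF // sqrtr_gt0 ltr_wpDr ?sqr_ge0.
have := atanK (y / x); rewrite /tan => /(canRL (divfK c0)) ->.
by rewrite mulrAC divfK // mulrC.
Qed.

(** Each nonzero coordinate of v other than the b-th is killed by a rotation
    in its plane with b, without disturbing the others; a unit vector is then
    left with b-th coordinate 1 or - 1, and a half turn involving the second
    index a of T repairs the sign. *)
Lemma givens_vector T a b (v : 'cV[R]_n) :
  (forall c e, c \in T -> e \in T -> rotates S c e) ->
  a \in T -> b \in T -> a != b ->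
  (forall c, c \notin T -> v c 0 = 0) -> v^T *m v = 1%:M ->
  exists2 g, block_word T g & g *m v = delta_mx b 0.
Proof.
move=> TS aT bT ab.
have [N] := ubnP #|[set c | (c != b) && (v c 0 != 0)]%SET|.
elim: N v => // N IH v vN vT v1.
have [[c /andP[cb vc0]]|nc] := pselect (exists c, (c != b) && (v c 0 != 0)).
  have cT : c \in T by apply: contraNT vc0 => /vT ->.
  have [t tE] := exists_killing_angle (v b 0) (v c 0).
  have bc : b != c by rewrite eq_sym.
  have gW := block_word_rotation t bc (TS _ _ bT cT) bT cT.
  set g := rotation _ t in gW; have [_ _ og _] := gW.
  have gvE e : e != b -> (g *m v) e 0 = (e != c)%:R * v e 0.
    move=> eb; rewrite rotation_col // !mxE (negbTE eb) /= mulr0 addr0 andbT.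
    have [->|ec] := eqVneq e c; last by rewrite mulr0 addr0 mul1r.
    by rewrite mulr1 mul0r tE; ring.
  have [//|e eT||h hW hE] := IH (g *m v).
  - move: vN; rewrite ltnS; apply: leq_trans; apply: proper_card; apply/properP; split.
      apply/fintype.subsetP => e; rewrite !inE => /andP[eb]; rewrite gvE // eb /=.
      by rewrite mulf_eq0 negb_or => /andP[].
    by exists c; rewrite !inE ?cb //= gvE // eqxx mul0r eqxx.
  - rewrite gvE; last by apply: contraNneq eT => ->.
    by rewrite vT // mulr0.
  - by rewrite trmx_mul -mulmxA (mulmxA g^T) og mul1mx.
  by exists (h *m g); [exact: block_word_mul|rewrite -mulmxA].
have v0 c : c != b -> v c 0 = 0.
  by move=> cb; apply/eqP; apply: contrapT => /negP vc; apply: nc; exists c; rewrite cb.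
have vE : v = v b 0 *: delta_mx b 0.
  apply/matrixP => c z; rewrite (ord1 z) !mxE.
  by have [->|/v0->] := eqVneq c b; rewrite ?mulr1 ?mulr0.
have : v b 0 ^+ 2 == 1.
  move/matrixP: v1 => /(_ 0 0); rewrite !mxE eqxx (bigD1 b) //= big1 => [|c /v0 cb].
    by rewrite !mxE addr0 -expr2 => ->.
  by rewrite !mxE cb mulr0.
rewrite sqrf_eq1 => /orP[/eqP vb|/eqP vb]; rewrite vb in vE.
  by exists 1%:M; [exact: block_word1|rewrite mul1mx vE scale1r].
exists (rotation (Omega R a b) pi); first by apply: block_word_rotation => //; exact: TS.
rewrite rotation_col // vb v0 // vE cospi sinpi.
by apply/matrixP => c z; rewrite !mxE; ring.
Qed.

(** Induction on T.  Moving the column b to e_b also makes the row b trivial,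
    by orthogonality, so the index b can be removed from T.  When a single
    index is left there is no plane to rotate in, and the sign of the last
    entry is settled by the determinant. *)
Lemma givens_block T Q :
  (forall c e, c \in T -> e \in T -> rotates S c e) ->
  supported_on T Q -> Q^T *m Q = 1%:M -> \det Q = 1 -> generated S Q.
Proof.
have [N] := ubnP #|T|; elim: N T Q => // N IH T Q TN TS TQ Qo Qd.
have [[b bT]|T0] := pselect (exists b, b \in T); last first.
  have -> : Q = 1%:M; last exact: generated1.
  apply/matrixP => a b; rewrite mxE TQ //; apply/negP => /andP[aT _].
  by apply: T0; exists a.
have [[a /andP[aT ab]]|Tb] := pselect (exists a, (a \in T) && (a != b)); last first.
  have Tb' a : a \in T -> a = b.
    move=> aT; apply/eqP; apply: contrapT => /negP ab; apply: Tb.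
    by exists a; rewrite aT.
  have QE : Q = diag_mx (\row_a Q a a).
    apply/matrixP => c e; rewrite !mxE.
    have [->|ce] := eqVneq c e; first by rewrite mulr1n.
    rewrite mulr0n TQ ?(negbTE ce) //.
    by apply: contra ce => /andP[/Tb'-> /Tb'->].
  have Qa a : a != b -> Q a a = 1.
    by move=> ab; rewrite TQ ?eqxx // negb_and; apply/orP; left; apply: contra ab => /Tb' ->.
  move: Qd; rewrite QE det_diag (bigD1 b) //= big1 => [|a /Qa]; last by rewrite mxE.
  rewrite mxE mulr1 => Qb; have -> : \row_a Q a a = const_mx 1.
    by apply/rowP => a; rewrite !mxE; have [->|/Qa] := eqVneq a b.
  by rewrite diag_const_mx; exact: generated1.
have [c cT||g [Sg Tg og dg] gQ] := @givens_vector T a b (col b Q) TS aT bT ab.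
- by rewrite mxE TQ ?negb_and ?cT //; case: eqP cT => // ->; rewrite bT.
- apply/matrixP => x y; rewrite !ord1; move/matrixP: Qo => /(_ b b).
  rewrite !mxE !eqxx => <-; apply: eq_bigr => c _; rewrite !mxE //.
have o' : (g *m Q)^T *m (g *m Q) = 1%:M.
  by rewrite trmx_mul -mulmxA (mulmxA g^T) og mul1mx.
have colb c : (g *m Q) c b = (c == b)%:R.
  have -> : (g *m Q) c b = (col b (g *m Q)) c 0 by rewrite [RHS]mxE.
  by rewrite colE -mulmxA -colE gQ mxE andbT.
(* An orthogonal matrix fixing e_b has a transpose fixing e_b. *)
have rowb c : (g *m Q) b c = (b == c)%:R.
  have : (g *m Q)^T *m delta_mx b 0 = delta_mx b 0 :> 'cV_n.
    by rewrite -{1}gQ colE mulmxA mulmxA -(mulmxA _ g Q) o' mul1mx.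
  by rewrite -colE => /matrixP/(_ c 0); rewrite !mxE eq_sym andbT.
have : generated S (g *m Q).
  apply: (IH (T :\ b)%SET) => //.
  - by move: TN; rewrite (cardsD1 b) bT.
  - by move=> c e; rewrite !inE => /andP[_ cT] /andP[_ eT]; exact: TS.
  - move=> c e; rewrite !inE.
    have [->|cb] := eqVneq c b; first by rewrite rowb.
    have [->|eb] := eqVneq e b; first by rewrite colb.
    by move=> /=; exact: supported_mul.
  - by rewrite det_mulmx dg Qd mulr1.
move=> SgQ; have -> : Q = g^T *m (g *m Q) by rewrite mulmxA og mul1mx.
by apply: generated_mul SgQ; exact: generated_tr.
Qed.

End GivensReduction.

(** * Block rotation groups are generated by plane rotations *)

Section CayleyWords.
Context {R : realType} {n : nat}.
Variable S : set 'M[R]_n.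
Hypothesis S_tr : forall X, S X -> S X^T.
Implicit Types (A : 'M[R]_n) (d : 'rV[R]_n).

(** Split off from A its restriction P A to one block T, where P is the
    projector on T.  Since A commutes with P, the two parts annihilate each
    other, so [cayleyD] factors the transform; the first factor is special
    orthogonal on T and is handled by [givens_block], the second has fewer
    nonzero rows. *)
Lemma cayley_generated d A :
  (forall a b, d 0 a = d 0 b -> rotates S a b) ->
  block_skew d A -> generated S (cayley A).
Proof.
move=> dS; have [N] := ubnP #|[set a | row a A != 0]%SET|.
elim: N A => // N IH A AN [At Ad].
have [[a ra]|A0] := pselect (exists a, row a A != 0); last first.
  have -> : A = 0; last by rewrite cayley0; exact: generated1.
  apply/row_matrixP => a; rewrite row0; apply/eqP; apply: contrapT => /negP ra.
  by apply: A0; exists a.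
pose T := [set b | d 0 b == d 0 a]%SET.
pose p : 'rV[R]_n := \row_b (b \in T)%:R; pose P := diag_mx p.
have PP : P *m P = P.
  rewrite /P mulmx_diag; congr diag_mx; apply/rowP => b; rewrite !mxE.
  by case: (b \in T); rewrite ?mulr1 ?mulr0.
have Pt : P^T = P by rewrite tr_diag_mx.
have PA : P *m A = A *m P.
  apply/comm_diag_mxP => b c; rewrite !mxE !inE => bc.
  by have /comm_diag_mxP H := Ad; apply: H; apply: contraNneq bc => ->.
have dP : comm_mx (diag_mx d) P by exact: diag_mx_comm.
set A1 := P *m A; set A2 := A - A1.
have A1t : A1^T = - A1 by rewrite trmx_mul Pt At mulNmx -PA.
have A2t : A2^T = - A2 by rewrite linearB /= At A1t opprB opprK addrC.
have A1P : A1 *m P = A1 by rewrite /A1 -mulmxA -PA mulmxA PP.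
have PA1 : P *m A1 = A1 by rewrite /A1 mulmxA PP.
have PA2 : P *m A2 = 0 by rewrite mulmxBr PA1 subrr.
have A2P : A2 *m P = 0 by rewrite mulmxBl A1P /A1 PA subrr.
have A12 : A1 *m A2 = 0 by rewrite -A1P -mulmxA PA2 mulmx0.
have A21 : A2 *m A1 = 0 by rewrite -PA1 mulmxA A2P mul0mx.
have A1d : comm_mx (diag_mx d) A1 by exact: comm_mxM.
have -> : A = A1 + A2 by rewrite addrC subrK.
rewrite cayleyD //; apply: generated_mul.
  (* B (1 - P) = 0, so 1 + B and hence the transform of B fix 1 - P. *)
  have fixP B : B^T = - B -> B *m P = B -> cayley B - cayley B *m P = 1%:M - P.
    move=> Bt BP; have uB := skew_unit Bt.
    rewrite -{1}[cayley B]mulmx1 -mulmxBr.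
    have E : invmx (1%:M + B) *m (1%:M - P) = 1%:M - P.
      rewrite -[RHS](mulKmx uB); congr (_ *m _).
      by rewrite mulmxDl mul1mx mulmxBr BP mulmx1 subrr addr0.
    by rewrite /cayley mulmxBl -scalemxAl E mul1mx scaler_nat mulr2n addrK.
  have fixT B c e : B^T = - B -> B *m P = B -> e \notin T ->
      cayley B c e = (c == e)%:R.
    move=> Bt BP eT; move: (cayley B) (fixP B Bt BP) => C /matrixP/(_ c e).
    rewrite mul_mx_diag !mxE (negbTE eT) mulr0 subr0 => ->.
    by have [->|_] := eqVneq c e; rewrite ?(negbTE eT) ?mul0rn ?mulr0n subr0.
  apply: (@givens_block _ _ _ S_tr T) => [c e|c e||].
  - by rewrite !inE => /eqP dc /eqP de; apply: dS; rewrite dc de.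
  - rewrite negb_and => /orP[cT|eT]; last exact: fixT.
    have -> : cayley A1 c e = cayley A1^T e c by rewrite -cayley_tr [RHS]mxE.
    rewrite eq_sym; apply: fixT => //; first by rewrite trmxK A1t opprK.
    by rewrite A1t mulNmx A1P.
  - exact: cayley_skew_orth.
  - exact: cayley_skew_det.
apply: IH => //; last by split => //; exact: comm_mxB.
have rA2 b : row b A2 = (b \notin T)%:R *: row b A.
  apply/rowP => c; rewrite /A2 /A1 /P mul_diag_mx !mxE.
  by case: (b \in T); rewrite ?mul1r ?subrr ?mul0r ?subr0 ?mul1r.
move: AN; rewrite ltnS; apply: leq_trans; apply: proper_card; apply/properP; split.
  apply/fintype.subsetP => b; rewrite !inE rA2 => H.
  by apply: contraNneq H => ->; rewrite scaler0.
by exists a; rewrite !inE // rA2 inE eqxx scale0r eqxx.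
Qed.

Lemma block_SO_generated d X :
  (forall a b, d 0 a = d 0 b -> rotates S a b) ->
  block_SO d X -> generated S X.
Proof.
by move=> dS; apply: generated_sub => _ [A Ad <-]; exact: cayley_generated Ad.
Qed.


End CayleyWords.

(** * A conserved quantity, and connectedness *)

Section Conservation.
Context {R : realType} {n : nat}.
Implicit Types (X Y Q A : 'M[R]_n) (d : 'rV[R]_n).

(** The derivative of F^T D F is F^T (A^T D + D A) F, which vanishes when A is
    skew and commutes with D. *)
Lemma conserved_frame d (F A : R -> 'M[R]_n) a b : a <= b ->
  {within `[a, b], continuous F} ->
  (forall s, s \in `]a, b[ -> is_derive s 1 F (A s *m F s) /\ block_skew d (A s)) ->
  (F b)^T *m (diag_mx d *m F b) = (F a)^T *m (diag_mx d *m F a).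
Proof.
move=> ab cF dF; pose phi s := (F s)^T *m (diag_mx d *m F s).
rewrite -/(phi b) -/(phi a); apply/matrixP => x y.
have [||c _] := @MVT_segment R (fun s => phi s x y) (fun=> 0) a b ab.
- move=> s /dF[dFs [At Ad]].
  have dFt := is_derive_linear (@trmx R n n) dFs.
  have dDF := is_derive_linear (mulmx (diag_mx d)) dFs.
  have /is_derive_mxP/(_ x y) := is_derive_mulmx dFt dDF.
  congr is_derive; rewrite /= trmx_mul At mulmxN mulNmx !mulmxA.
  by rewrite -[_ *m A s *m diag_mx d]mulmxA -Ad !mulmxA addNr mxE.
- move=> s; have FF : Filter (nbhs s) := nbhs_filter s.
  have Fs : F @ (nbhs s) --> F s := cF s.
  have Fts : (F z)^T @[z --> nbhs s] --> (F s)^T.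
    exact: (@cvg_mx_linear R _ n n n n _ FF F (@trmx R n n) _ Fs).
  have DFs : diag_mx d *m F z @[z --> nbhs s] --> diag_mx d *m F s.
    exact: (@cvg_mx_linear R _ n n n n _ FF F (mulmx (diag_mx d)) _ Fs).
  have /cvg_mxP := @cvg_mulmx R _ n n n _ FF _ _ _ _ Fts DFs; exact.
by rewrite mul0r => /eqP; rewrite subr_eq0 => /eqP.
Qed.

Lemma block_orth_frame d X : X^T *m X = 1%:M ->
  X^T *m (diag_mx d *m X) = diag_mx d -> block_orth d X.
Proof.
move=> Xo /(congr1 (mulmx X)) E; split=> //.
by move: E; rewrite mulmxA (orth_tr Xo) mul1mx.
Qed.

Lemma open_unitmx {T : topologicalType} (f : T -> 'M[R]_n) :
  continuous f -> open [set x | f x \in unitmx].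
Proof.
move=> cf; have -> : [set x | f x \in unitmx] =
    (fun x => \det (f x)) @^-1` [set y | y != 0].
  by apply/seteqP; split => x /=; rewrite unitmxE unitfE.
apply: open_comp; last exact: open_neq.
by move=> x _; apply: cvg_det; exact: cf.
Qed.

Lemma open_near_group X : open [set Y : 'M[R]_n | 1%:M + Y *m X^T \in unitmx].
Proof.
apply: open_unitmx => Y.
exact: (@cvgD _ _ _ _ (nbhs_filter Y) _ _ _ _ (@cvg_cst _ _ _ _ _)
  (@mx_linear_continuous R n n n n (mulmxr X^T) Y)).
Qed.

(** By [block_SO_step] both K `&` block_SO and its complement in K are
    relatively open. *)
Lemma connected_block_SO d (K : set 'M[R]_n) X :
  connected K -> K `<=` block_orth d -> K X -> block_SO d X -> K `<=` block_SO d.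
Proof.
move=> cK KO KX GX; pose N Y := [set Z : 'M[R]_n | 1%:M + Z *m Y^T \in unitmx].
have NY Y : K Y -> N Y Y.
  by move=> /KO[Yo _]; rewrite /N /= orth_tr // unitmx_1D1.
suff <- : K `&` block_SO d = K by move=> Y [].
apply: cK; first by exists X.
- exists (\bigcup_(Y in K `&` block_SO d) N Y).
    by apply: bigcup_open => Y _; exact: open_near_group.
  apply/seteqP; split=> [Y [KY GY]|Y [KY [Z [KZ GZ] ZY]]].
    by split=> //; exists Y => //; exact: NY.
  by split=> //; apply: block_SO_near ZY GZ; exact: KO.
(* The complement is open for the same reason, the nearness being symmetric. *)
- exists (~` \bigcup_(Y in K `\` block_SO d) N Y).
    by apply: open_closedC; apply: bigcup_open => Y _; exact: open_near_group.
  apply/seteqP; split=> [Y [KY GY]|Y [KY nY]]; split=> //.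
    move=> [Z [KZ nZ] ZY]; apply: nZ.
    apply: (block_SO_near (X := Y)) GY; [exact: KO|exact: KO|].
    by rewrite -unitmx_tr linearD /= trmx1 trmx_mul trmxK.
  by apply: contrapT => GY; apply: nY; exists Y => //; exact: NY.
Qed.

End Conservation.

(** * Trajectories of the control system *)

Section Controllability.
Context {R : realType} {n m : nat}.
Variables i j : 'I_m -> 'I_n.
Implicit Types (Y : 'M[R]_n) (d : 'rV[R]_n).

Lemma subdivision_le (T : R) N t a b : subdivision T N t -> (a <= b <= N)%N ->
  t a <= t b.
Proof.
move=> [_ _ tS]; elim: b => [|b IH] /andP[ab bN].
  by move: ab; rewrite leqn0 => /eqP ->.
move: ab; rewrite leq_eqVlt => /orP[/eqP-> //|ab].
by apply: le_trans (IH _) (ltW (tS _ bN)); rewrite -ltnS ab ltnW.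
Qed.

(** Continuity at the break points allows the conserved quantity to be
    propagated through the pieces of the subdivision, up to any point of a
    piece. *)
Lemma trajectory_block_orth d (T : R) u X :
  (forall q, d 0 (i q) = d 0 (j q)) -> trajectory i j T u X ->
  forall s, s \in `[0, T] -> block_orth d (X s).
Proof.
move=> dij [X0 cX SX [N [t [tS tX]]]] s sT.
have [t0 tN _] := tS.
have skew c : block_skew d (\sum_q c q *: Omega R (i q) (j q)).
  split.
    rewrite linear_sum -sumrN; apply: eq_bigr => q _.
    by rewrite linearZ /= Omega_tr scalerN.
  apply: comm_mx_sum => q _; apply: comm_mxZ.
  by have [] := block_skew_Omega (dij q).
suff H a : (a <= N)%N -> forall s, s \in `[0, t a] ->
    (X s)^T *m (diag_mx d *m X s) = diag_mx d.
  apply: block_orth_frame; first by have [] := SX s sT.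
  by apply: (H N (leqnn N)); rewrite tN.
elim: a => [_|a IH aN] {sT}s.
  rewrite t0 in_itv /= => s0; have -> : s = 0 by apply/eqP; rewrite eq_le andbC.
  by rewrite X0 trmx1 mul1mx mulmx1.
rewrite in_itv /= => /andP[s0 sa].
have [sle|slt] := leP s (t a); first by apply: (IH (ltnW aN)); rewrite in_itv /= s0.
have ta0 : 0 <= t a by rewrite -t0; apply: (subdivision_le tS); rewrite leq0n ltnW.
have taN : t a.+1 <= T by rewrite -tN; apply: (subdivision_le tS); rewrite aN leqnn.
have [_ dX] := tX a aN.
rewrite -[RHS](IH (ltnW aN) (t a)); last by rewrite in_itv /= ta0 lexx.
apply: (@conserved_frame _ _ d X (fun s => \sum_q u q s *: Omega R (i q) (j q))).
- exact: ltW.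
- apply: continuous_subspaceW cX => r /=; rewrite !in_itv /= => /andP[ar rs].
  by rewrite (le_trans ta0 ar) (le_trans rs (le_trans sa taN)).
- move=> r; rewrite in_itv /= => /andP[ar rs]; split; last exact: skew.
  by apply: dX; rewrite in_itv /= ar (lt_le_trans rs sa).
Qed.

Lemma controllable_sub_block_SO d :
  (forall q, d 0 (i q) = d 0 (j q)) ->
  controllable_submanifold i j `<=` block_SO d.
Proof.
move=> dij Y [T [u [X [T0 tr <-]]]].
have [X0 cX _ _] := tr.
have KX s : s \in `[0, T] -> (X @` `[0, T]) (X s) by move=> sT; exists s.
have := @connected_block_SO R n d (X @` `[0, T]) (X 0); apply.
- by apply: connected_continuous_connected cX; exact: segment_connected.
- by move=> _ [s sT <-]; exact: trajectory_block_orth tr _ sT.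
- by apply: KX; rewrite in_itv /= lexx.
- by rewrite X0; exact: generated1.
- by apply: KX; rewrite in_itv /= lexx T0.
Qed.

Lemma controllable1 : controllable_submanifold i j (1%:M : 'M[R]_n).
Proof.
exists 0, (fun _ _ => 0), (fun=> 1%:M); split=> //; split=> //.
- by apply: continuous_subspaceT => s; exact: cvg_cst.
- by move=> s _; split; rewrite ?trmx1 ?mulmx1 ?det1.
- by exists 0%N, (fun=> 0).
Qed.

Lemma is_derive_rotation_speed (W Y : 'M[R]_n) (c T s : R) :
  W *m W *m W = - W ->
  is_derive s 1 (fun r : R => rotation W ((r - T) * c) *m Y)
    ((c *: W) *m (rotation W ((s - T) * c) *m Y)).
Proof.
move=> W3.
have dl : is_derive s 1 (fun r : R => (r - T) * c) c.
  have -> : (fun r : R => (r - T) * c) = (id - cst T) * cst c by apply/funext.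
  apply: is_derive_eq; rewrite subr0 scaler0 add0r /GRing.scale /= mulr1 //.
have dr : is_derive s 1 (fun r : R => rotation W ((r - T) * c))
    ((c *: W) *m rotation W ((s - T) * c)).
  apply/is_derive_mxP => a b.
  have /is_derive_mxP/(_ a b) dW := is_derive_rotation ((s - T) * c) W3.
  have H := @is_derive1_comp R (fun y => rotation W y a b)
    (fun r => (r - T) * c) s _ _ dW dl.
  apply: (is_derive_eq H).
  by rewrite -scalemxAl [RHS]mxE mulrC.
rewrite mulmxA.
exact: (@is_derive_linear R R n n n n _ (mulmxr Y) _ _ _ dr).
Qed.

(** Prolong the trajectory by one unit of time during which only the control q
    is switched on, with constant value c. *)
Lemma controllable_rotation q (c : R) Y : i q != j q ->
  controllable_submanifold i j Y ->
  controllable_submanifold i j (rotation (Omega R (i q) (j q)) c *m Y).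
Proof.
move=> ij [T [u [X [T0 [X0 cX SX [N [t [tS tX]]]] XT]]]].
set W := Omega R (i q) (j q); have [Wt W3] := Omega_rotation_skew (R := R) ij.
pose G := fun s : R => rotation W ((s - T) * c) *m Y.
pose X' (s : R) := if s <= T then X s else G s.
pose u' p (s : R) := if s <= T then u p s else (p == q)%:R * c.
pose t' a := if (a <= N)%N then t a else T + 1.
have [t0 tN tlt] := tS.
have GT : G T = Y by rewrite /G subrr mul0r rotation0 mul1mx.
have dG (s : R) : is_derive s 1 G ((c *: W) *m G s) := is_derive_rotation_speed Y c T s W3.
have X'r (s : R) : T <= s -> X' s = G s.
  rewrite /X'; case: ifP => // sT Ts.
  have -> : s = T by apply/eqP; rewrite eq_le sT.
  by rewrite XT GT.
have X'l (s : R) : s <= T -> X' s = X s by rewrite /X' => ->.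
have T1 : T <= T + 1 by rewrite lerDl.
exists (T + 1), u', X'; split; first exact: addr_ge0.
  split.
  - by rewrite X'l.
  - rewrite (@itv_bndbnd_setU _ _ _ (BRight T)) ?bnd_simp //.
    have cl x y : closed (`[x, y] : set R) := @itv_closed _ _ x y.
    (* Continuity is pasted along closed sets, so T is put in both intervals. *)
    have eqT : [set` Interval (BRight T) (BRight (T + 1))] `<=` `[T, T + 1].
      by move=> s /=; rewrite !in_itv /= => /andP[/ltW -> ->].
    have -> : `[0, T] `|` `]T, T + 1] = `[0, T] `|` `[T, T + 1] :> set R.
      apply/seteqP; split=> s [sT|sT]; [by left|by right; exact: eqT|by left|].
      have [sle|slt] := leP s T; [left|right]; move: sT; rewrite /= !in_itv /=.
        by move=> /andP[Ts _]; rewrite sle (le_trans T0).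
      by move=> /andP[_ ->]; rewrite slt.
    apply: withinU_continuous; [exact: cl|exact: cl| |].
      apply: subspace_eq_continuous cX => s; rewrite inE /= in_itv /= => /andP[_ sT].
      exact: esym (X'l s sT).
    have cG : {within `[T, T + 1], continuous G}.
      by apply: derivable_within_continuous => s _; have [] := dG s.
    apply: subspace_eq_continuous cG => s; rewrite inE /= in_itv /= => /andP[Ts _].
    exact: esym (X'r s Ts).
  - move=> s; rewrite in_itv /= => /andP[s0 sT1].
    have [sT|sT] := leP s T; first by rewrite X'l //; apply: SX; rewrite in_itv /= s0.
    rewrite X'r ?ltW // /G; have [|Yo Yd] := SX T; rewrite ?in_itv /= ?T0 ?lexx //.
    rewrite XT in Yo Yd; split; last by rewrite det_mulmx rotation_det // Yd mulr1.
    by rewrite trmx_mul -mulmxA (mulmxA (rotation _ _)^T) rotation_orth // mul1mx.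
  - exists N.+1, t'; split.
      split; rewrite /t' ?leq0n ?ltnn // => a; rewrite ltnS => aN; rewrite aN.
      by case: ltnP => [/tlt//|Na]; have -> : a = N; [apply/eqP; rewrite eqn_leq aN|rewrite tN ltrDl].
    move=> a; rewrite ltnS leq_eqVlt => /orP[/eqP->|aN].
      rewrite /t' leqnn ltnn tN; split.
        by exists (fun p => (p == q)%:R * c) => p s; rewrite in_itv /= /u' => /andP[Ts _]; rewrite leNgt Ts.
      move=> s; rewrite in_itv /= => /andP[Ts _].
      have -> : \sum_p u' p s *: Omega R (i p) (j p) = c *: W.
        rewrite (bigD1 q) //= big1 => [|p pq]; rewrite /u' leNgt Ts /=.
          by rewrite eqxx mul1r addr0.
        by rewrite (negbTE pq) mul0r scale0r.
      rewrite X'r ?ltW //; apply: near_eq_is_derive (dG s).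
      by near=> r; rewrite X'r // ltW //; near: r; exact: lt_nbhsr.
    rewrite /t' aN ltnW //; have [[v vE] dX] := tX a aN.
    have taT : t a.+1 <= T by rewrite -tN; apply: (subdivision_le tS); rewrite aN leqnn.
    split.
      exists v => p s sa; rewrite /u'; case: ifP => [_|/negP[]]; first exact: vE.
      by move: sa; rewrite in_itv /= => /andP[_ /ltW sa]; exact: le_trans taT.
    move=> s sa; have sT : s < T.
      by move: sa; rewrite in_itv /= => /andP[_ sa]; exact: lt_le_trans taT.
    rewrite X'l ?ltW //; under eq_bigr do rewrite /u' (ltW sT).
    apply: near_eq_is_derive (dX s sa).
    by near=> r; rewrite X'l // ltW //; near: r; exact: lt_nbhsl.
by rewrite X'r // /G addrAC subrr add0r mul1r.
Unshelve. all: by end_near. Qed.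

End Controllability.

(** * Orbits of permutations and the controllable set *)

Section Orbits.
Context {R : realType} {n : nat}.
Implicit Types (s t : 'S_n) (a b x y : 'I_n).

(** Orbits are encoded by distinct scalars, so that being block diagonal for
    them is commuting with one diagonal matrix. *)
Definition orbit_label s : 'rV[R]_n := \row_a (enum_rank (porbit s a))%:R.

Lemma orbit_labelP s a b :
  (orbit_label s 0 a == orbit_label s 0 b) = (b \in porbit s a).
Proof.
rewrite !mxE eqr_nat -eq_porbit_mem [RHS]eq_sym.
by apply/eqP/eqP => [/val_inj/enum_rank_inj|->].
Qed.

Lemma perm_class_eqP s t : perm_class s = perm_class t <->
  forall a b, (b \in porbit s a) = (b \in porbit t a).
Proof.
split=> [/setP/(_ t)|st].
  rewrite !inE eqxx => /eqP st a b.
  have: porbit s a \in porbits t by rewrite -st; apply/imsetP; exists a.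
  move=> /imsetP[c _ E]; have : a \in porbit s a by exact: porbit_id.
  by rewrite E -eq_porbit_mem => /eqP ->.
have E : porbits s = porbits t.
  by apply: eq_imset => a; apply/setP => b; exact: st.
by apply/setP => u; rewrite !inE E.
Qed.

Section DisjointCycles.
Variables (k : nat) (sigma : 'I_k -> 'S_n) (O : 'I_k -> {set 'I_n}).
Hypothesis hcycle : forall l, cycle_with_orbit (sigma l) (O l).
Hypothesis hdisj : forall l l', l != l' -> [disjoint O l & O l']%B.

Lemma cycle_porbit l x : x \in O l -> porbit (sigma l) x = O l.
Proof.
move=> xO; have /setP/(_ (O l)) := hcycle l; rewrite !inE eqxx => /andP[/imsetP[y _ E] _].
by move: xO; rewrite E -eq_porbit_mem => /eqP.
Qed.

Lemma cycle_fix l x : x \notin O l -> sigma l x = x.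
Proof.
move=> xO; have /setP/(_ (porbit (sigma l) x)) := hcycle l; rewrite !inE.
rewrite imset_f //=; have -> : (porbit (sigma l) x == O l) = false.
  by apply: contraNF xO => /eqP <-; exact: porbit_id.
move=> /negbT; rewrite -leqNgt => /card_le1_eqP H; apply: H; rewrite ?porbit_id //.
by have := mem_porbit (sigma l) 1 x; rewrite expg1.
Qed.

(** The other cycles fix O l pointwise, and the l-th one preserves it. *)
Lemma prod_cycles_in l x (r : seq 'I_k) : uniq r -> l \in r -> x \in O l ->
  (\prod_(l' <- r) sigma l')%g x = sigma l x.
Proof.
have out l' y : l' != l -> y \in O l -> sigma l' y = y.
  move=> ll yO; apply: cycle_fix; apply/negP => yO'.
  by have /disjointFr/(_ yO') := hdisj ll; rewrite yO.
(* After the l-th cycle, the remaining ones act trivially on O l. *)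
have rest (r' : seq 'I_k) y : l \notin r' -> y \in O l ->
    (\prod_(l' <- r') sigma l')%g y = y.
  elim: r' => [|l' r' IH]; first by rewrite big_nil perm1.
  rewrite inE negb_or big_cons permM eq_sym => /andP[ll lr] yO.
  by rewrite out // IH.
elim: r => // l' r IH /= /andP[l'r ur]; rewrite inE big_cons permM.
have [e _ xO|ll /= lr xO] := eqVneq l l'; last by rewrite out 1?eq_sym // IH.
rewrite -e in l'r *; apply: rest => //.
by rewrite -(cycle_porbit xO); have := mem_porbit (sigma l) 1 x; rewrite expg1.
Qed.

Lemma prod_cycles_out x : (forall l, x \notin O l) ->
  (\prod_(l < k) sigma l)%g x = x.
Proof.
move=> xO; elim/big_rec: _ => [|l s _ IH]; first by rewrite perm1.
by rewrite permM cycle_fix.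
Qed.

Lemma porbit_prod_cycles a b : b \in porbit (\prod_(l < k) sigma l)%g a <->
  a = b \/ exists l, (a \in O l) && (b \in O l).
Proof.
set p := (\prod_(l < k) sigma l)%g.
have pin l x : x \in O l -> p x = sigma l x.
  by apply: prod_cycles_in; rewrite ?mem_index_enum ?index_enum_uniq.
have [[l aO]|aO] := pselect (exists l, a \in O l); last first.
  have pa : p a = a.
    by apply: prod_cycles_out => l; apply/negP => aOl; apply: aO; exists l.
  split=> [/porbitP[q ->]|[->|[l /andP[aOl _]]]]; first 2 last.
  - by case: aO; exists l.
  - left; elim: q => [|q IH]; first by rewrite expg0 perm1.
    by rewrite expgS permM pa.
  - exact: porbit_id.
have -> : porbit p a = porbit (sigma l) a.
  have E q : (p ^+ q)%g a = (sigma l ^+ q)%g a.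
    elim: q => [|q IH]; first by rewrite !expg0.
    rewrite !expgSr !permM IH; apply: pin.
    by rewrite -(cycle_porbit aO) mem_porbit.
  by apply/setP => c; apply/porbitP/porbitP => -[q ->]; exists q; rewrite E.
rewrite (cycle_porbit aO); split=> [bO|[<-//|[l' /andP[aO' bO']]]].
  by right; exists l; rewrite aO.
have [->//|ll] := eqVneq l l'.
by have /disjointFr/(_ aO) := hdisj ll; rewrite aO'.
Qed.

End DisjointCycles.

(** Each factor of the star product merges at most two orbits, and the
    rotations in its plane link these. *)
Lemma rotates_star_prod (S : set 'M[R]_n) (r : seq ('I_n * 'I_n)) x y :
  (forall p, p \in r -> rotates S p.1 p.2) ->
  y \in porbit (star_prod r) x -> rotates S x y.
Proof.
elim/last_ind: r x y => [|r p IH] x y rS.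
  move=> /porbitP[q ->]; rewrite expg1n perm1; exact: rotates_refl.
have rS' p' : p' \in r -> rotates S p'.1 p'.2.
  by move=> pr; apply: rS; rewrite mem_rcons inE pr orbT.
have pS : rotates S p.1 p.2 by apply: rS; rewrite mem_rcons mem_head.
have H u v : v \in porbit (star_prod r) u -> rotates S u v by exact: IH.
rewrite /star_prod foldl_rcons -/(star_prod r) porbit_star.
case/or3P => [/H//|/andP[/H xp /H py]|/andP[/H xp /H py]].
  exact: rotates_trans (rotates_trans xp pS) py.
exact: rotates_trans (rotates_trans xp (rotates_sym pS)) py.
Qed.

Lemma star_prod_edge (r : seq ('I_n * 'I_n)) p :
  p \in r -> p.2 \in porbit (star_prod r) p.1.
Proof.
elim/last_ind: r => // r p' IH; rewrite mem_rcons inE.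
rewrite /star_prod foldl_rcons -/(star_prod r) porbit_star.
by move=> /orP[/eqP->|/IH->//]; rewrite !porbit_id orbT.
Qed.

Lemma controllable_block_SO m (i j : 'I_m -> 'I_n) :
  (forall q, i q != j q) ->
  controllable_submanifold i j =
  block_SO (orbit_label (star_prod [seq (i q, j q) | q <- enum 'I_m])).
Proof.
move=> ij; set r := [seq _ | _ <- _]; set d := orbit_label _.
have edge q : (i q, j q) \in r by apply/mapP; exists q; rewrite ?mem_enum.
apply/seteqP; split.
  apply: controllable_sub_block_SO => q; apply/eqP; rewrite orbit_labelP.
  exact: star_prod_edge (edge q).
pose S : set 'M[R]_n :=
  [set rotation (Omega R (i p.1) (j p.1)) p.2 | p in [set: 'I_m * R]].
have S_tr X : S X -> S X^T.
  move=> [[q c] _ <-]; exists (q, - c) => //=.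
  by rewrite rotation_tr ?Omega_tr.
move=> X /(block_SO_generated S_tr) GX.
have {GX} : generated S X.
  apply: GX => a b /eqP; rewrite orbit_labelP; apply: rotates_star_prod => p.
  move=> /mapP[q _ -> c]; apply: generated_mem.
  by exists (q, c).
elim=> [|_ Y [[q c] _ <-] _ IH]; first exact: controllable1.
exact: controllable_rotation.
Qed.

End Orbits.

(** * Coordinates on a space of matrices, and the calculus of the Cayley transform *)

Section Coordinates.
Context {R : realType} {n : nat}.
Variable V : {vspace 'M[R]_n}.

Definition from_coords (v : 'rV[R]_(\dim V)) : 'M[R]_n :=
  \sum_q v 0 q *: (vbasis V)`_q.

Lemma from_coords_linear : linear from_coords.
Proof.
move=> c v w; rewrite /from_coords scaler_sumr -big_split /=.
by apply: eq_bigr => q _; rewrite !mxE scalerDl scalerA.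
Qed.

HB.instance Definition _ :=
  GRing.isLinear.Build R _ _ _ from_coords from_coords_linear.

Definition to_coords (A : 'M[R]_n) : 'rV[R]_(\dim V) :=
  \row_q coord (vbasis V) q A.

Lemma to_coords_linear : linear to_coords.
Proof. by move=> c A B; apply/rowP => q; rewrite !mxE linearP. Qed.

HB.instance Definition _ :=
  GRing.isLinear.Build R _ _ _ to_coords to_coords_linear.

Lemma from_coordsK : cancel from_coords to_coords.
Proof.
move=> v; apply/rowP => q; rewrite mxE coord_sum_free //.
exact: basis_free (vbasisP V).
Qed.

Lemma to_coordsK A : A \in V -> from_coords (to_coords A) = A.
Proof.
move=> AV; rewrite [RHS](coord_vbasis AV); apply: eq_bigr => q _.
by rewrite mxE.
Qed.

Lemma from_coords_mem v : from_coords v \in V.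
Proof.
by apply: memv_suml => q _; apply: memvZ; apply: vbasis_mem; rewrite mem_nth // size_tuple.
Qed.

End Coordinates.

Section CayleyCalculus.
Context {R : realType} {n : nat} {W : normedModType R}.

Lemma is_derive_cayley (f : W -> 'M[R]_n) x v df :
  1%:M + f x \in unitmx -> is_derive x v f df ->
  is_derive x v (fun y => cayley (f y))
    (- (2 *: (invmx (1%:M + f x) *m df *m invmx (1%:M + f x)))).
Proof.
move=> u fx; have d1 : is_derive x v (fun y => 1%:M + f y) df.
  have := is_deriveD (is_derive_cst (1%:M : 'M[R]_n) x v) fx.
  by rewrite add0r.
have d2 := is_derive_linear ( *:%R 2) (@is_derive_invmx _ _ _ (fun y => 1%:M + f y) _ _ _ u d1).
have := is_deriveB d2 (is_derive_cst (1%:M : 'M[R]_n) x v).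
by rewrite subr0 /= scalerN.
Qed.

Lemma class_C_cayley k (U : set W) (f : W -> 'M[R]_n) : open U ->
  (forall x, U x -> 1%:M + f x \in unitmx) ->
  class_C k U f -> class_C k U (fun x => cayley (f x)).
Proof.
move=> oU u fC.
have c1 : class_C k U (fun x => 1%:M + f x) := class_CD oU (class_C_cst _ _ _) fC.
have c2 := class_C_comp_linear ( *:%R 2) oU (class_C_invmx oU u c1).
exact: (class_CD oU c2 (class_C_cst _ _ (- 1%:M))).
Qed.

End CayleyCalculus.

(** * The block rotation group as an integral manifold *)

(** Two points are joined by a segment, which is connected. *)
Lemma clopen_normed (R : realType) (W : normedModType R) (U : set W) : open U -> open (~` U) ->
  forall x y, U x -> U y.
Proof.
move=> oU oC x y Ux; pose c (s : R) := s *: (y - x) + x.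
(* The segment from x to y; U cuts out a clopen part of it. *)
have cc : continuous c.
  move=> s; apply: cvgD; last exact: cvg_cst.
  exact: scalel_continuous.
pose K := c @` `[0, 1].
have cK : connected K.
  apply: connected_continuous_connected; first exact: segment_connected.
  exact: continuous_subspaceT.
have Kx : K x by exists 0; rewrite /c /= ?in_itv /= ?lexx ?ler01 ?scale0r ?add0r.
have Ky : K y by exists 1; rewrite /c /= ?in_itv /= ?lexx ?ler01 ?scale1r ?subrK.
suff E : K `&` U = K by move: Ky; rewrite -E => -[].
apply: cK; [by exists x|by exists U|exists U => //].
by rewrite -[U]setCK; exact: open_closedC.
Qed.

Section IntegralManifold.
Context {R : realType} {n : nat}.
Variables (d : 'rV[R]_n) (V : {vspace 'M[R]_n}) (Delta : 'M[R]_n -> {vspace 'M[R]_n}).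
Hypothesis memV : forall A, A \in V <-> block_skew d A.
Hypothesis memDelta : forall X w,
  w \in Delta X <-> exists2 A, block_skew d A & w = A *m X.
Implicit Types (A X Y g h : 'M[R]_n) (x y v : 'rV[R]_(\dim V)).

Let skewV x : block_skew d (from_coords x). Proof. exact/memV/from_coords_mem. Qed.

Let unitV x : 1%:M + from_coords x \in unitmx.
Proof. by apply: skew_unit; have [] := skewV x. Qed.

Definition cayley_chart g : parametrization R (\dim V) n :=
  Parametrization [set: 'rV[R]_(\dim V)] (fun x => cayley (from_coords x) *m g).

Definition cayley_atlas : set (parametrization R (\dim V) n) :=
  [set cayley_chart g | g in block_SO d].

Lemma is_derive_from_coords x v :
  is_derive x v (@from_coords R n V) (from_coords v).
Proof. exact: (is_derive_linear (from_coords (V := V)) (is_derive_id x v)). Qed.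

Lemma class_C_from_coords k (U : set 'rV[R]_(\dim V)) : open U ->
  class_C k U (@from_coords R n V).
Proof.
move=> oU; exact: (class_C_comp_linear (from_coords (V := V)) oU (class_C_id k oU)).
Qed.

Lemma cayley_chart_smooth g k (U : set 'rV[R]_(\dim V)) : open U ->
  class_C k U (fun x => cayley (from_coords x) *m g).
Proof.
move=> oU; apply: (class_C_mulmx oU _ (class_C_cst k U g)).
by apply: (class_C_cayley oU) => [x _|]; [exact: unitV|exact: class_C_from_coords].
Qed.

(** The Lie algebra element A' such that the derivative of the Cayley
    transform at A in the direction B is A' cayley A. *)
Definition tangent_map A B : 'M[R]_n :=
  - (2 *: (invmx (1%:M + A) *m B *m (invmx (1%:M + A))^T)).

(** The derivative - 2 (1 + A)^-1 B (1 + A)^-1 of the transform is made into a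
    multiple of cayley A = (1 - A) (1 + A)^-1 by inserting (1 - A)^-1 (1 - A),
    where (1 - A)^-1 is the transpose of (1 + A)^-1. *)
Lemma is_derive_cayley_chart g x v :
  is_derive x v (cayley_chart g)
    (tangent_map (from_coords x) (from_coords v) *m cayley_chart g x).
Proof.
have H := is_derive_cayley (unitV x) (is_derive_from_coords x v).
apply: (is_derive_eq (is_derive_linear (mulmxr g) H)) => /=.
have [At _] := skewV x; have u := unitV x.
move: (from_coords x) (from_coords v) At u => A B At u.
have Jt : (invmx (1%:M + A))^T = invmx (1%:M - A).
  by rewrite trmx_inv -At -[in RHS](trmx1 R n) -linearD.
have u' : 1%:M - A \in unitmx by rewrite -At -(trmx1 R n) -linearD /= unitmx_tr.
rewrite mulmxA; congr (_ *m g); rewrite /tangent_map mulNmx -scalemxAl.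
by rewrite Jt cayleyE // !mulmxA -(mulmxA _ (invmx (1%:M - A))) mulVmx ?mulmx1.
Qed.

Lemma tangent_map_skew A B : block_skew d A -> block_skew d B ->
  block_skew d (tangent_map A B).
Proof.
move=> [At Ad] [Bt Bd]; have u := skew_unit At.
have c : comm_mx (diag_mx d) (invmx (1%:M + A)).
  by apply: comm_mxV => //; apply: comm_mxD => //; exact: comm_mx1.
split.
  rewrite /tangent_map linearN linearZ /= !trmx_mul trmxK Bt mulNmx mulmxN.
  by rewrite mulmxA scalerN.
apply: comm_mxN; apply: comm_mxZ; apply: comm_mxM; last exact: comm_diag_tr.
exact: comm_mxM.
Qed.

(** The tangent map is congruence by (1 + A)^-1, up to the factor - 2, which
    preserves skewness and is inverted by congruence by 1 + A. *)
Lemma tangent_map_surj A C : block_skew d A -> block_skew d C ->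
  exists2 B, block_skew d B & tangent_map A B = C.
Proof.
move=> [At Ad] [Ct Cd]; have u := skew_unit At.
have c : comm_mx (diag_mx d) (1%:M + A) by apply: comm_mxD => //; exact: comm_mx1.
exists (- (2^-1 *: ((1%:M + A) *m C *m (1%:M + A)^T))).
  split.
    rewrite linearN linearZ /= !trmx_mul trmxK Ct mulNmx mulmxN.
    by rewrite mulmxA scalerN.
  apply: comm_mxN; apply: comm_mxZ; apply: comm_mxM; last exact: comm_diag_tr.
  exact: comm_mxM.
rewrite /tangent_map mulmxN mulNmx scalerN opprK -scalemxAr -scalemxAl scalerA.
rewrite divff ?pnatr_eq0 // scale1r !mulmxA mulVmx // mul1mx -mulmxA -trmx_mul.
by rewrite mulVmx // trmx1 mulmx1.
Qed.

Lemma tangent_map_inj A B : block_skew d A -> tangent_map A B = 0 -> B = 0.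
Proof.
move=> [At _]; have u := skew_unit At.
move=> /eqP; rewrite oppr_eq0 scaler_eq0 pnatr_eq0 /= => /eqP E.
have := congr1 (fun M => (1%:M + A) *m M *m (1%:M + A)^T) E.
rewrite mulmx0 mul0mx -!mulmxA mulKVmx // mulmxA -mulmxA -trmx_mul mulmxV //.
by rewrite trmx1 mulmx1.
Qed.

Lemma block_SO_unit X : block_SO d X -> X \in unitmx.
Proof. by move=> /block_SO_orth[Xo _]; have [] := mulmx1_unit Xo. Qed.

Lemma cayley_chart_immersive g : block_SO d g -> immersive_param (cayley_chart g).
Proof.
move=> Gg; have ug := block_SO_unit Gg; split.
- exact: openT.
- by move=> k; apply: cayley_chart_smooth; exact: openT.
- move=> x y _ _ /= /(congr1 (mulmx^~ (invmx g))); rewrite !mulmxK //.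
  move=> /(congr1 cayley); rewrite !cayleyK //.
  by move=> /(congr1 (to_coords V)); rewrite !from_coordsK.
- move=> x _ v; have [_ ->] := is_derive_cayley_chart g x v.
  move=> /(congr1 (mulmx^~ (invmx (cayley_chart g x)))); rewrite mul0mx mulmxK.
    move=> /(tangent_map_inj (skewV x)) /(congr1 (to_coords V)).
    by rewrite from_coordsK linear0.
  apply: block_SO_unit; apply: generated_mul Gg; exact: block_SO_cayley.
Qed.

(** An element of the group is a Cayley transform precisely when - 1 is not
    one of its eigenvalues. *)
Lemma cayley_chart_image g h x : block_SO d g -> block_SO d h ->
  (cayley_chart h @` [set: 'rV[R]_(\dim V)]) (cayley_chart g x) <->
  1%:M + cayley (from_coords x) *m (g *m h^T) \in unitmx.
Proof.
move=> Gg Gh; have [ho _] := block_SO_orth Gh.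
have Qo : block_orth d (cayley (from_coords x) *m (g *m h^T)).
  apply: block_orth_mul; first exact: block_orth_cayley.
  by apply: block_orth_mul; [exact: block_SO_orth|apply: block_orth_tr; exact: block_SO_orth].
split=> [[y _ /= E]|u].
  by rewrite mulmxA -E -mulmxA (orth_tr ho) mulmx1; apply: cayley_unit.
exists (to_coords V (cayley (cayley (from_coords x) *m (g *m h^T)))) => //=.
rewrite to_coordsK; last by apply/memV; exact: block_skew_cayley.
by rewrite cayleyK // -!mulmxA ho mulmx1.
Qed.

(** By [cayley_chart_image] the overlap is given by the nonvanishing of a
    determinant, and the transition map is a composite of two Cayley
    transforms and linear maps. *)
Lemma cayley_chart_compatible g h : block_SO d g -> block_SO d h ->
  compatible (cayley_chart g) (cayley_chart h).
Proof.
move=> Gg Gh; have [ho _] := block_SO_orth Gh.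
pose q x := cayley (from_coords x) *m (g *m h^T).
pose D := [set x | 1%:M + q x \in unitmx].
have DE : pdom (cayley_chart g) `&`
    cayley_chart g @^-1` (cayley_chart h @` pdom (cayley_chart h)) = D.
  apply/seteqP; split=> x.
    by move=> [_ /(cayley_chart_image _ Gg Gh)].
  by move=> /(cayley_chart_image _ Gg Gh) u; split.
have qC k U : open U -> class_C k U q := @cayley_chart_smooth _ k U.
have oD : open D.
  apply: open_unitmx => x.
  have c1 := class_CD openT (class_C_cst 0 setT (1%:M : 'M[R]_n)) (qC 0%N setT openT).
  exact: class_C_continuous c1 I.
rewrite /compatible DE; split=> //; exists (fun x => to_coords V (cayley (q x))); split.
  move=> k; apply: (class_C_comp_linear (to_coords V) oD).
  by apply: (class_C_cayley oD) (qC k D oD) => x.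
move=> x u; split=> //=.
rewrite to_coordsK; first by rewrite cayleyK // /q -!mulmxA ho mulmx1.
apply/memV; apply: block_skew_cayley => //.
apply: block_orth_mul; first exact: block_orth_cayley.
by apply: block_orth_mul; [exact: block_SO_orth|apply: block_orth_tr; exact: block_SO_orth].
Qed.

(** The domain of a chart is a whole space of row vectors, so a clopen set
    that meets the image of a chart contains it.  As X and cayley A *m X lie
    in the image of a common chart, induction along the generators reaches the
    whole group. *)
Lemma block_SO_connected : manifold_connected (block_SO d) cayley_atlas.
Proof.
split; first by exists 1%:M; exact: generated1.
move=> W [WG oW] [_ oC].
have chart g x y : block_SO d g -> W (cayley_chart g x) -> W (cayley_chart g y).
  move=> Gg; have ag : cayley_atlas (cayley_chart g) by exists g.
  have G z : block_SO d (cayley_chart g z).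
    by apply: generated_mul Gg; exact: block_SO_cayley.
  apply: (@clopen_normed _ _ (cayley_chart g @^-1` W)); first by have H := oW _ ag; rewrite setTI in H.
  have H := oC _ ag; rewrite setTI in H.
  have <- : cayley_chart g @^-1` (block_SO d `\` W) = ~` (cayley_chart g @^-1` W).
    by apply/seteqP; split=> z; [case|move=> nW; split; first exact: G].
  exact: H.
have step A X : block_skew d A -> block_SO d X -> W X <-> W (cayley A *m X).
  move=> Ad GX.
  have e0 : cayley_chart X 0 = X by rewrite /= linear0 cayley0 mul1mx.
  have eA : cayley_chart X (to_coords V A) = cayley A *m X.
    by rewrite /= to_coordsK //; exact/memV.
  by rewrite -{1}e0 -eA; split; exact: chart.
have W1 X : block_SO d X -> W X <-> W 1%:M.
  by elim=> [//|_ Y [A Ad <-] GY IH]; rewrite -step.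
have [w|nw] := pselect (W 1%:M); [right|left].
  by apply/seteqP; split=> // X GX; apply/W1.
by apply/seteqP; split=> // X WX; apply: nw; apply/(W1 X) => //; exact: WG.
Qed.

Lemma block_SO_integral_manifold : connected_integral_manifold Delta (block_SO d).
Proof.
split; first exact: block_SO_sub.
exists (\dim V), cayley_atlas; split; [split| |].
- by move=> _ [g Gg <-]; exact: cayley_chart_immersive.
- by move=> _ _ [g Gg <-] [h Gh <-]; exact: cayley_chart_compatible.
- apply/seteqP; split=> [g Gg|_ [_ [g Gg <-] [x _ <-]]].
    exists (cayley_chart g); first by exists g.
    by exists 0 => //=; rewrite linear0 cayley0 mul1mx.
  by apply: generated_mul Gg; exact: block_SO_cayley.
- exact: block_SO_connected.
- move=> _ [g Gg <-] x _ w; rewrite memDelta; split.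
    move=> [v <-]; have [_ ->] := is_derive_cayley_chart g x v.
    by exists (tangent_map (from_coords x) (from_coords v)) => //; exact: tangent_map_skew.
  move=> [A Ad ->]; have [B Bd <-] := tangent_map_surj (skewV x) Ad.
  exists (to_coords V B); have [_ ->] := is_derive_cayley_chart g x (to_coords V B).
  by rewrite to_coordsK //; exact/memV.
Qed.

End IntegralManifold.

(** * Integral manifolds stay inside the block rotation group *)

Section IntegralManifoldsInside.
Context {R : realType} {n : nat}.
Variables (d : 'rV[R]_n) (Delta : 'M[R]_n -> {vspace 'M[R]_n}).
Hypothesis memDelta : forall X w,
  w \in Delta X <-> exists2 A, block_skew d A & w = A *m X.

Lemma is_derive_line {V W : normedModType R} (f : V -> W) (x v : V) (s : R) df :
  is_derive (s *: v + x) v f df -> is_derive s 1 (fun r : R => f (r *: v + x)) df.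
Proof.
move=> [fs <-]; have E : (fun h : R => h^-1 *: (f (h *: v + (s *: v + x)) - f (s *: v + x)))
    = (fun h : R => h^-1 *: (f ((h *: (1 : R) + s) *: v + x) - f (s *: v + x))).
  by apply/funext => h; rewrite scalerDl addrA [h *: 1]mulr1.
by apply: DeriveDef; [rewrite /derivable /= -E|rewrite /derive /= -E].
Qed.

(** Tangency to Delta makes c a solution of X' = A X with A skew and block
    diagonal; then c(1)^T D c(1) = c(0)^T D c(0), which says that c(1) c(0)^T
    commutes with D. *)
Lemma line_block_orth (c : R -> 'M[R]_n) :
  (forall s : R, s \in `[0, 1] -> exists2 w, is_derive s 1 c w & w \in Delta (c s)) ->
  (c 0)^T *m c 0 = 1%:M -> (c 1)^T *m c 1 = 1%:M ->
  block_orth d (c 1 *m (c 0)^T).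
Proof.
move=> dc c0 c1.
have /boolp.choice[A AE] : forall s : R, exists B, s \in `[0, 1] ->
    is_derive s 1 c (B *m c s) /\ block_skew d B.
  move=> s.
  have [s01|ns] := boolP (s \in `[0, 1]%R); last by exists 0.
  have [w dw /memDelta[B Bd wE]] := dc s s01.
  by exists B => _; rewrite -wE.
have E : (c 1)^T *m (diag_mx d *m c 1) = (c 0)^T *m (diag_mx d *m c 0).
  apply: (@conserved_frame _ _ d c A 0 1); first exact: ler01.
    by apply: derivable_within_continuous => s /AE[[]].
  by move=> s /subset_itv_oo_cc /AE.
split; first by rewrite trmx_mul trmxK -mulmxA (mulmxA (c 1)^T) c1 mul1mx orth_tr.
have := congr1 (fun M => c 1 *m M *m (c 0)^T) E.
rewrite !mulmxA orth_tr // mul1mx -!mulmxA orth_tr // mulmx1 /comm_mx => ->.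
by rewrite mulmxA.
Qed.

(** A nearby point of the chart is joined to x0 by a segment inside the chart,
    to which [line_block_orth] applies; continuity then makes the quotient of
    the two values a Cayley transform. *)
Lemma integral_manifold_near N (phi : parametrization R N n) x0 :
  immersive_param phi -> (forall x, pdom phi x -> SO (phi x)) ->
  (forall x, pdom phi x -> forall w, (exists v, 'D_v phi x = w) <-> w \in Delta (phi x)) ->
  pdom phi x0 ->
  \forall x \near x0, pdom phi x /\ (block_SO d (phi x) <-> block_SO d (phi x0)).
Proof.
move=> [oU sphi _ _] SOphi tphi Ux0.
have c1 := sphi 1%N; have phic := class_C_continuous c1 Ux0.
have [e /= e0 eU] : nbhs_ball x0 (pdom phi).
  by apply/nbhs_ballP; exact: open_nbhs_nbhs.
(* The quotient of the two values is 1 at x0, where 1 + 1 is invertible. *)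
have nX : nbhs (phi x0) [set Y | 1%:M + Y *m (phi x0)^T \in unitmx].
  apply: open_nbhs_nbhs; split; first exact: open_near_group.
  by rewrite /= orth_tr ?unitmx_1D1 //; have [] := SOphi _ Ux0.
near=> x.
have xe : ball x0 e x by near: x; exact: nbhsx_ballx.
have line (s : R) : s \in `[0, 1] -> pdom phi (s *: (x - x0) + x0).
  rewrite in_itv /= => /andP[s0 s1]; apply: eU.
  move: xe; rewrite -!ball_normE /ball_ /= opprD addrCA subrr addr0 normrN normrZ distrC.
  apply: le_lt_trans; rewrite -[leRHS]mul1r ler_wpM2r // ger0_norm //.
have Ux : pdom phi x by exact: eU.
have [xo _] := SOphi _ Ux; have [x0o _] := SOphi _ Ux0.
have Q : block_orth d (phi x *m (phi x0)^T).
  pose c (s : R) := phi (s *: (x - x0) + x0).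
  have c0E : c 0 = phi x0 by rewrite /c scale0r add0r.
  have c1E : c 1 = phi x by rewrite /c scale1r subrK.
  rewrite -c0E -c1E; apply: line_block_orth; rewrite ?c0E ?c1E // => s s01.
  exists ('D_(x - x0) phi (s *: (x - x0) + x0)).
    by apply: is_derive_line; apply: class_C_derive c1 _; exact: line.
  by apply/tphi; [exact: line|exists (x - x0)].
have uQ : 1%:M + phi x *m (phi x0)^T \in unitmx by near: x; exact: phic nX.
split=> //; split=> GX.
  have -> : phi x0 = (phi x *m (phi x0)^T)^T *m phi x.
    by rewrite trmx_mul trmxK -mulmxA xo mulmx1.
  apply: block_SO_step GX; first exact: block_orth_tr.
  by rewrite -unitmx_tr linearD /= trmx1 trmxK.
have -> : phi x = (phi x *m (phi x0)^T) *m phi x0 by rewrite -mulmxA x0o mulmx1.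
exact: block_SO_step GX.
Unshelve. all: by end_near. Qed.

Lemma integral_manifold_sub N : connected_integral_manifold Delta N -> N 1%:M ->
  N `<=` block_SO d.
Proof.
move=> [NSO [k [atlas [[imm _ NE] [_ Nc] tan]]]] N1.
have phiN phi x : atlas phi -> pdom phi x -> N (phi x).
  by move=> aphi Ux; rewrite NE; exists phi => //; exists x.
have loc phi x0 (aphi : atlas phi) (Ux0 : pdom phi x0) :=
  integral_manifold_near (imm _ aphi) (fun x Ux => NSO _ (phiN _ x aphi Ux))
    (tan _ aphi) Ux0.
have [||E|E] := Nc (N `&` block_SO d).
- split; first by move=> X [].
  move=> phi aphi; rewrite openE => x0 [Ux0 [_ G0]].
  by apply: filterS (loc _ _ aphi Ux0) => x [Ux /iffRL/(_ G0) Gx]; split=> //; split; [exact: phiN|].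
- split; first by move=> X [].
  move=> phi aphi; rewrite openE => x0 [Ux0 [_ G0]].
  apply: filterS (loc _ _ aphi Ux0) => x [Ux [Gx _]]; split=> //; split; first exact: phiN.
  by move=> [_ /Gx G']; apply: G0; split=> //; exact: phiN.
- have : (N `&` block_SO d) 1%:M by split => //; exact: generated1.
  by rewrite E.
- by move=> X; rewrite -{1}E => -[].
Qed.

End IntegralManifoldsInside.

(** * The distribution, and the equivalence *)

Section BlockPartition.
Context {R : realType} {n : nat}.
Implicit Types (d : 'rV[R]_n) (A X w : 'M[R]_n).

(** The transform of Omega_ab lies in the first group, hence commutes with the
    second diagonal matrix; so does its own transform, which is Omega_ab. *)
Lemma block_SO_sub_label d d' (a b : 'I_n) :
  block_SO d `<=` block_SO d' -> d 0 a = d 0 b -> d' 0 a = d' 0 b.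
Proof.
move=> sub dab; have [->//|ab] := eqVneq a b.
have Wd := block_skew_Omega dab; have u := skew_unit Wd.1.
have [_ /(comm_mx_cayley (cayley_unit u))] :=
  block_SO_orth (sub _ (block_SO_cayley Wd)).
rewrite cayleyK // => /comm_diag_mxP W0; apply/eqP/negPn/negP => /W0.
rewrite !mxE !eqxx (negbTE ab) /= subr0 => /eqP; by rewrite oner_eq0.
Qed.

Lemma block_SO_eq_label d d' :
  (forall a b, (d 0 a == d 0 b) = (d' 0 a == d' 0 b)) -> block_SO d = block_SO d'.
Proof.
move=> dd'; congr generated; congr image; apply/seteqP.
split=> A [At /comm_diag_mxP Ad]; split=> //; apply/comm_diag_mxP => a b dab.
  by apply: Ad; rewrite dd'.
by apply: Ad; rewrite -dd'.
Qed.

Lemma skew_sum_Omega A : A^T = - A ->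
  A = \sum_a \sum_b (A a b / 2) *: Omega R a b.
Proof.
move=> At; have E : A = 2^-1 *: (A - A^T).
  by rewrite At opprK -mulr2n -(scaler_nat 2 A) scalerA mulVf ?scale1r // pnatr_eq0.
rewrite {1}E {1}(matrix_sum_delta A) [X in _ - X](_ : _ =
    \sum_a \sum_b A a b *: delta_mx b a).
  rewrite -sumrB scaler_sumr; apply: eq_bigr => a _.
  rewrite -sumrB scaler_sumr; apply: eq_bigr => b _.
  by rewrite -scalerBr scalerA mulrC.
rewrite {1}(matrix_sum_delta A) linear_sum; apply: eq_bigr => a _.
by rewrite linear_sum; apply: eq_bigr => b _; rewrite linearZ /= trmx_delta.
Qed.

(** The vectors Omega_ab X with a, b in a common O l span the products A X,
    because a skew A is the sum over all (a, b) of A_ab / 2 times Omega_ab and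
    only the pairs inside a block contribute. *)
Lemma Delta_sumP k (O : 'I_k -> {set 'I_n}) d X w :
  (forall a b, d 0 a = d 0 b <-> a = b \/ exists l, (a \in O l) && (b \in O l)) ->
  w \in Delta_sum O X <-> exists2 A, block_skew d A & w = A *m X.
Proof.
move=> dO; split.
  pose P v := exists2 A, block_skew d A & v = A *m X.
  have P0 : P 0.
    exists 0; rewrite ?mul0mx //; split; first by rewrite trmx0 oppr0.
    by apply/comm_diag_mxP => a b _; rewrite mxE.
  have PD v v' : P v -> P v' -> P (v + v').
    move=> [A [At Ad] ->] [B [Bt Bd] ->]; exists (A + B); rewrite ?mulmxDl //.
    by split; [rewrite linearD /= At Bt opprD|exact: comm_mxD].
  have PZ c v : P v -> P (c *: v).
    move=> [A [At Ad] ->]; exists (c *: A); rewrite ?scalemxAl //.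
    by split; [rewrite linearZ /= At scalerN|exact: comm_mxZ].
  move=> /memv_sumP[ws wsO ->]; apply: (big_ind P) => // l _.
  have := wsO l isT; rewrite /Delta_orbit; set s := [seq _ | _ <- _, _ <- _] => wl.
  have /coord_span -> : ws l \in <<in_tuple s>>%VS by [].
  apply: (big_ind P) => // q _; apply: PZ.
  have /allpairsP[[a b] [/= aO bO ->]] := mem_nth 0 (ltn_ord q).
  rewrite !mem_enum in aO bO; exists (Omega R a b) => //.
  by apply: block_skew_Omega; apply/dO; right; exists l; rewrite aO.
move=> [A [At /comm_diag_mxP A0] ->]; rewrite (skew_sum_Omega At) mulmx_suml.
apply: memv_suml => a _; rewrite mulmx_suml; apply: memv_suml => b _.
rewrite -scalemxAl; have [/eqP/dO [->|[l /andP[aO bO]]]|/A0->] := boolP (d 0 a == d 0 b).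
- by rewrite /Omega subrr mul0mx scaler0 mem0v.
- apply: memvZ; have : (Delta_orbit (O l) X <= Delta_sum O X)%VS by exact: (sumv_sup l).
  move=> /subvP; apply; apply: memv_span; apply/allpairsP; exists (a, b).
  by rewrite !mem_enum.
- by rewrite mul0r scale0r mem0v.
Qed.

End BlockPartition.

Theorem corollary2 (R : realType) (n : nat) (hn : (3 <= n)%N)
    (m : nat) (i j : 'I_m -> 'I_n) (hij : forall q, (i q < j q)%N)
    (k : nat) (sigma : 'I_k -> 'S_n) (O : 'I_k -> {set 'I_n})
    (hcycle : forall l, cycle_with_orbit (sigma l) (O l))
    (hdisj : forall l l', l != l' -> [disjoint O l & O l']%B) :
  maximal_integral_manifold_through (@Delta_sum R n k O) 1%:M
    (controllable_submanifold i j)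
  <->
  iota_tilde [set Omega R (i q) (j q) | q in [set: 'I_m]] =
    perm_class (\prod_(l < k) sigma l)%g.
Proof.
set p := (\prod_(l < k) sigma l)%g; pose d : 'rV[R]_n := orbit_label p.
pose r := [seq (i q, j q) | q <- enum 'I_m]; pose s := star_prod r.
have -> : iota_tilde [set Omega R (i q) (j q) | q in [set: 'I_m]] = perm_class s.
  rewrite -(@iota_tildeE R n r) => [|_ /mapP[q _ ->]]; last exact: hij.
  congr iota_tilde; apply/seteqP; split=> [_ [q _ <-]|_ [_ /mapP[q _ ->] <-]].
    by exists (i q, j q) => //=; apply/mapP; exists q; rewrite ?mem_enum.
  by exists q.
have ij q : i q != j q by apply: contraTneq (hij q) => ->; rewrite ltnn.
rewrite controllable_block_SO // -/r -/s.
have dO a b : d 0 a = d 0 b <-> a = b \/ exists l, (a \in O l) && (b \in O l).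
  rewrite -(porbit_prod_cycles hcycle hdisj) -(orbit_labelP (R := R)).
  by split=> /eqP.
have memDelta X w := Delta_sumP X w dO.
have memV A : A \in Delta_sum O (1%:M : 'M[R]_n) <-> block_skew d A.
  rewrite memDelta; split=> [[B Bd ->]|Ad]; first by rewrite mulmx1.
  by exists A; rewrite ?mulmx1.
have intG := block_SO_integral_manifold memV memDelta.
have G1 : block_SO d 1%:M by exact: generated1.
transitivity (block_SO (orbit_label s) = block_SO d).
  split=> [[intC C1 maxC]|->].
    have sub := integral_manifold_sub memDelta intC C1.
    exact: esym (maxC _ intG sub).
  split=> // N intN GN; apply/seteqP; split=> //.
  exact: (integral_manifold_sub memDelta intN (GN _ G1)).
split=> [E|/perm_class_eqP sp].
  apply/perm_class_eqP => a b; rewrite -!(orbit_labelP (R := R)).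
  by apply/eqP/eqP; apply: block_SO_sub_label; rewrite E.
by apply: block_SO_eq_label => a b; rewrite !orbit_labelP sp.
Qed.
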